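(* Let $2\mathbb{D}=\{z\in\mathbb{C}:|z|\le 2\}$. The spectral measure $\nu_{\rho_1}$ (over $2\mathbb{D}$) for the graph $\mathcal{G}^{\mathbb{Z}_2^{(3)}}_{\rho_1}$ for $U(2)$ is given by $$\mathrm{d}\nu_{\rho_1}(x)=\frac{1}{2\pi^2}\sqrt{4-|x|^2}\,\mathrm{d}x,\qquad x\in2\mathbb{D},$$ where $\mathrm{d}x$ means $\mathrm{d}r\,\mathrm{d}\theta$ for $x=re^{i\theta}$, $0\le r\le2$, $0\le\theta<2\pi$; whilst the spectral measure $\nu_{\rho_2}$ (over $\mathbb{T}$) for the graph $\mathcal{G}^{\mathbb{Z}_2^{(3)}}_{\rho_2}$ for $U(2)$ is given by $\mathrm{d}\nu_{\rho_2}(y)=(2\pi)^{-1}\,\mathrm{d}y$, $y\in\mathbb{T}$, where $\mathrm{d}y$ is arc length on the unit circle.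
   Context: Let $P_+=\{\lambda=(\lambda_1,\lambda_2)\in\mathbb{Z}^2:\lambda_1\ge\lambda_2\}$ and, for $\lambda\in P_+$, let $\chi_\lambda(\omega_1,\omega_2)=\dfrac{\omega_1^{\lambda_1+1}\omega_2^{\lambda_2}-\omega_1^{\lambda_2}\omega_2^{\lambda_1+1}}{\omega_1-\omega_2}$ on $\mathbb{T}^2$ (the irreducible characters of $U(2)$, whose Weyl group is $\mathbb{Z}_2^{(3)}=\langle\begin{pmatrix}0&1\\1&0\end{pmatrix}\rangle$). Put $\rho_1=(1,0)$, $\rho_2=(1,1)$, so $\chi_{\rho_1}=\omega_1+\omega_2$, $\chi_{\rho_2}=\omega_1\omega_2$. The graph $\mathcal{G}^{\mathbb{Z}_2^{(3)}}_{\rho}$ has vertex set $P_+$ and $m^\rho_{\mu\nu}$ directed edges from $\mu$ to $\nu$, where $\chi_\rho\chi_\mu=\sum_\nu m^\rho_{\mu\nu}\chi_\nu$. The adjacency matrix is $\Delta_\rho=(m^\rho_{\mu\nu})_{\mu,\nu}$, acting as a bounded normal operator on $\ell^2(P_+)$ by the fusion rule $\delta_\mu\mapsto\sum_\nu m^\rho_{\mu\nu}\delta_\nu$ (i.e. paths are followed along edges). The distinguished vertex is $\ast=(0,0)$ (a vertex which is the source of only one edge of $\mathcal{G}_{\rho_1}$). The $(m,n)$ moment counts pairs consisting of a path of $m$ edges on the graph starting at $\ast$ followed by a path of $n$ edges on the opposite graph (all orientations reversed) returning to $\ast$; this is the moment $\varphi(\Delta_\rho^m(\Delta_\rho^* )^n)$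 in the paper's notation. The spectral measure $\nu_\rho$ of the graph is the unique compactly supported probability measure on $\chi_\rho(\mathbb{T}^2)$ ($2\mathbb{D}$ for $\rho_1$, $\mathbb{T}$ for $\rho_2$) whose moments $\int z^m\overline{z}^n\,\mathrm{d}\nu_\rho(z)$ equal these numbers for all integers $m,n\ge0$. *)

(* Defs.v *)
From HB Require Import structures.
From mathcomp Require Import all_boot all_order all_algebra.
From mathcomp Require Import complex.
From mathcomp Require Import all_classical all_reals all_analysis.

Set Implicit Arguments.
Unset Strict Implicit.
Unset Printing Implicit Defensive.
Import Order.TTheory GRing.Theory Num.Theory.

Local Open Scope classical_set_scope.
Local Open Scope ring_scope.
Local Open Scope complex_scope.

(* A directed multigraph on V is given by its multiplicities: [mult x y] is the
   number of edges from x to y. *)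
Section Multigraph.
Variables (V : choiceType) (mult : V -> V -> nat).

Definition edge : choiceType := {xy : V * V & 'I_(mult xy.1 xy.2)}.
Definition source (e : edge) : V := (tag e).1.
Definition target (e : edge) : V := (tag e).2.

(* [is_path source target] describes the paths of the graph and
   [is_path target source] those of the opposite graph. *)
Fixpoint is_path (s t : edge -> V) (x : V) (p : seq edge) (y : V) : Prop :=
  if p is e :: p' then s e = x /\ is_path s t (t e) p' y else x = y.

Definition path_pairs (x0 : V) (m n : nat) : set (seq edge * seq edge) :=
  [set pq | [/\ size pq.1 = m, size pq.2 = n &
     exists x, is_path source target x0 pq.1 x /\
               is_path target source x pq.2 x0]].

End Multigraph.

Arguments path_pairs {V} mult x0 m n.

Section SpectralMeasure.
Variable R : realType.

(* The complex plane as a measurable space is R * R with its product (i.e.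
   Borel) sigma-algebra. *)
Definition toC (p : R * R) : R[i] := p.1 +i* p.2.

Definition cmoment (nu : probability (R * R)%type R) (m n : nat) : R[i] :=
  let f (p : R * R) : R[i] := toC p ^+ m * (toC p)^* ^+ n in
  (Rintegral nu setT (fun p => complex.Re (f p)))
    +i* (Rintegral nu setT (fun p => complex.Im (f p))).

(* Requiring the set of pairs of paths to be in bijection with `I_k includes its
   finiteness. *)
Definition has_graph_moments (V : choiceType) (mult : V -> V -> nat) (x0 : V)
    (K : set R[i]) (nu : probability (R * R)%type R) : Prop :=
  nu (toC @^-1` (~` K)) = 0%E /\
  forall m n : nat, exists2 k : nat,
    (path_pairs mult x0 m n #= `I_k)%card & cmoment nu m n = k%:R.

Definition is_spectral_measure (V : choiceType) (mult : V -> V -> nat) (x0 : V)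
    (K : set R[i]) (nu : probability (R * R)%type R) : Prop :=
  has_graph_moments mult x0 K nu /\
  forall nu' : probability (R * R)%type R, has_graph_moments mult x0 K nu' ->
    forall A, measurable A -> nu' A = nu A.

End SpectralMeasure.

(* The dominant weights P_+ of U(2). *)
Definition weight : choiceType := {l : int * int | l.2 <= l.1}.

Definition rho1 : weight := exist _ (1, 0) isT.
Definition rho2 : weight := exist _ (1, 1) isT.
Definition weight0 : weight := exist _ (0, 0) isT.

Section Characters.
Variable R : realType.

(* On the diagonal the quotient is understood as its continuous extension. *)
Definition chi (l : weight) (w1 w2 : R[i]) : R[i] :=
  let l1 := (val l).1 in let l2 := (val l).2 in
  if w1 == w2 then (l1 - l2 + 1)%:~R * w1 ^ (l1 + l2)
  else (w1 ^ (l1 + 1) * w2 ^ l2 - w1 ^ l2 * w2 ^ (l1 + 1)) / (w1 - w2).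

Definition unit_circle : set R[i] := [set w | `|w| = 1].

Definition chi_image (rho : weight) : set R[i] :=
  [set z | exists w1 w2, [/\ unit_circle w1, unit_circle w2 &
                             z = chi rho w1 w2]].

Definition is_fusion_rule (rho : weight) (m : weight -> weight -> nat) : Prop :=
  forall mu, finite_set [set nu | m mu nu <> 0%N] /\
    forall w1 w2, unit_circle w1 -> unit_circle w2 ->
      chi rho w1 w2 * chi mu w1 w2 =
      \sum_(nu \in [set nu | m mu nu <> 0%N]) (m mu nu)%:R * chi nu w1 w2.

(* The multiplicities are determined by the fusion rule, the characters being
   linearly independent; the default value is irrelevant. *)
Definition fusion_mult (rho : weight) : weight -> weight -> nat :=
  xget (fun _ _ => 0%N) [set m | is_fusion_rule rho m].

Definition is_U2_spectral_measure (rho : weight)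
    (nu : probability (R * R)%type R) : Prop :=
  is_spectral_measure (fusion_mult rho) weight0 (chi_image rho) nu.

Definition polar (p : R * R) : R * R := (p.1 * cos p.2, p.1 * sin p.2).

Definition polar_domain (r0 : R) : set (R * R) :=
  `[0, r0]%classic `*` `[0, 2 * pi[%classic.

(* The integral over A of f against dr dtheta, where x = r e^(i theta) with
   0 <= r <= r0; this is not the area element r dr dtheta. *)
Definition integral_drdtheta (r0 : R) (A : set (R * R)) (f : R[i] -> R) :
    \bar R :=
  \int[(@lebesgue_measure R \x @lebesgue_measure R)%E]_(p in
      polar_domain r0 `&` polar @^-1` A) (f (toC (polar p)))%:E.

Definition arc_length (A : set (R * R)) : \bar R :=
  lebesgue_measure (`[0, 2 * pi[%classic `&`
                    [set t : R | A (polar (1, t))]).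

End Characters.

(* Main.v *)
(* By linear independence of the characters (Dedekind's argument on the torus) the
   fusion rules determine the graphs: an edge adds a weight of the fundamental
   representation for rho1, and (1, 1) for rho2, where all paths are forced.  For rho1
   the weight (l1, l2) enters the path counts only through d = l1 - l2, which every step
   changes by one while keeping it nonnegative.  Since
   2 cos t sin((d + 1) t) = sin(d t) + sin((d + 2) t), the counts obey the same recursion
   as the integrals of (2 cos t)^j sin((d + 1) t) sin t over [0, pi / 2].  At d = 0 the
   substitution r = 2 cos t turns these into the radial moments of the claimed density,
   and the angular integral kills the moments with m <> n.  Uniqueness: the polynomials
   (1 - p^n)^(n 2^n) tend boundedly to the indicator of p < 1/2 on [0, 1], so taking p
   affine in a coordinate shows that the moments determine the measures of quadrants. *)

Require Import Defs.
From HB Require Import structures.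
From mathcomp Require Import all_boot all_order all_algebra.
From mathcomp Require Import complex finmap.
From mathcomp Require Import all_classical all_reals all_analysis.
From mathcomp Require Import measurable_realfun.
From mathcomp Require Import ring lra zify.

Set Implicit Arguments.
Unset Strict Implicit.
Unset Printing Implicit Defensive.
Import Order.TTheory GRing.Theory Num.Theory.
Import numFieldNormedType.Exports.

Local Open Scope classical_set_scope.
Local Open Scope ring_scope.
Local Open Scope complex_scope.

(** A step leaving the dominant chamber is lost, and the recursion for the path counts must respect
    this. On the integral side it is automatic, because the missing neighbour d = -1 would carry the
    factor sin 0 = 0; on the character side the formula vanishes on the wall. When no step is left
    the total degree l1 + l2 is zero, so d is even. This parity permits the half interval
    [0, pi / 2], on which 2 cos t runs exactly once through the radii [0, 2]. Both measures are
    images, under polar coordinates, of probabilities with a density on a parameter space; for dr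
    dtheta no Jacobian appears. Compact support makes every polynomial integrable and keeps affine
    functions in a bounded interval, as the step approximation requires. Products of such
    approximations reach intersections of half-planes, so the sets on which two measures are seen to
    agree form a generating family stable under intersection. *)

Section UnitCircle.
Variable R : realType.
Implicit Types (s t : R) (z w : R[i]).

(** * Exponentials on the circle and their linear independence *)

Definition cis t : R[i] := cos t +i* sin t.

Lemma cis0 : cis 0 = 1.
Proof. by rewrite /cis cos0 sin0. Qed.

Lemma cisD s t : cis (s + t) = cis s * cis t.
Proof. by rewrite /cis cosD sinD; simpc; congr (_ +i* _); rewrite addrC. Qed.

Lemma cis_conj t : (cis t)^* = cis (- t).
Proof. by rewrite /cis cosN sinN. Qed.

Lemma cis_norm t : `|cis t| = 1.
Proof. by rewrite normc_def /= cos2Dsin2 sqrtr1. Qed.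

Lemma cis_neq0 t : cis t != 0.
Proof. by rewrite -normr_eq0 cis_norm oner_neq0. Qed.

Lemma cisV t : (cis t)^-1 = cis (- t).
Proof.
by apply: (mulfI (cis_neq0 t)); rewrite mulfV ?cis_neq0 // -cisD subrr cis0.
Qed.

Lemma cisX t n : cis t ^+ n = cis (n%:R * t).
Proof.
elim: n => [|n IH]; first by rewrite expr0 mul0r cis0.
by rewrite exprS IH -cisD -add1n natrD mulrDl mul1r.
Qed.

Lemma cisXz t (a : int) : cis t ^ a = cis (a%:~R * t).
Proof.
case: a => n; first exact: cisX.
by rewrite (_ : _ ^ _ = (cis t ^+ n.+1)^-1) // cisX cisV NegzE mulrNz mulNr.
Qed.

Lemma cis_pi : cis pi = -1.
Proof. by rewrite /cis cospi sinpi; apply/eqP; rewrite eq_complex /= oppr0 !eqxx. Qed.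

Lemma unit_circle_cis t : unit_circle (cis t).
Proof. exact: cis_norm. Qed.

Lemma unit_circle_neq0 z : unit_circle z -> z != 0.
Proof. by rewrite /unit_circle /= -normr_eq0 => ->; rewrite oner_neq0. Qed.

(* Dedekind's argument: subtracting from the relation at [t + h] the
   [cis (n * h)]-multiple of the relation at [t] shortens it. *)
Lemma cis_independent (I : eqType) (r : seq I) (e : I -> int * int)
    (c : I -> R[i]) :
  uniq r -> {in r &, injective e} ->
  (forall s t, \sum_(i <- r) c i * cis ((e i).1%:~R * s + (e i).2%:~R * t) = 0) ->
  {in r, forall i, c i = 0}.
Proof.
elim: r c => [//|i0 r IH] c /= /andP[i0r ur] inje rel0.
have er i j : i \in r -> j \in r -> e i = e j -> i = j.
  by move=> ir jr; apply: inje; rewrite inE ?ir ?jr orbT.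
have c0 i : i \in r -> c i = 0.
  move=> ir.
  have [s [t st]] : exists s t,
      cis ((e i).1%:~R * s + (e i).2%:~R * t) !=
      cis ((e i0).1%:~R * s + (e i0).2%:~R * t).
    (* If the exponents differ in one coordinate, setting that variable to pi over the difference
       makes the two exponentials opposite. *)
    have piN (x : R) : cis (x + pi) != cis x.
      rewrite cisD cis_pi mulrN1 -subr_eq0 -opprD oppr_eq0 -mulr2n mulrn_eq0 /=.
      exact: cis_neq0.
    have : e i != e i0.
      apply: contraNneq i0r => /inje <- //; first by rewrite inE ir orbT.
      exact: mem_head.
    rewrite -pair_eqE /= negb_and => /orP[] ne.
      exists (pi / ((e i).1 - (e i0).1)%:~R), 0.
      rewrite !mulr0 !addr0.
      rewrite -[(e i).1](subrK (e i0).1) rmorphD /= mulrDl addrC.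
      rewrite [X in cis (_ + X)]mulrC addrK divfK ?piN // intr_eq0 subr_eq0 //.
    exists 0, (pi / ((e i).2 - (e i0).2)%:~R).
    rewrite !mulr0 !add0r.
    rewrite -[(e i).2](subrK (e i0).2) rmorphD /= mulrDl addrC.
    by rewrite [X in cis (_ + X)]mulrC addrK divfK ?piN // intr_eq0 subr_eq0.
  pose f j := cis ((e j).1%:~R * s + (e j).2%:~R * t).
  suff /eqP : c i * (f i - f i0) = 0.
    by rewrite mulf_eq0 subr_eq0 (negPf st) orbF => /eqP.
  apply: (IH (fun j => c j * (f j - f i0))) => // s' t'.
  have := rel0 (s' + s) (t' + t); have := rel0 s' t'.
  rewrite !big_cons => /(congr1 ( *%R^~ (f i0))); rewrite mul0r => e1 e2.
  have := congr2 (fun x y => x - y) e2 e1; rewrite subr0 mulrDl.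
  have fD j : cis ((e j).1%:~R * (s' + s) + (e j).2%:~R * (t' + t)) =
      cis ((e j).1%:~R * s' + (e j).2%:~R * t') * f j.
    by rewrite -cisD; congr cis; rewrite !mulrDr addrACA.
  rewrite fD mulrA opprD addrACA subrr add0r mulr_suml -sumrB => e3.
  rewrite -[RHS]e3.
  by apply: eq_bigr => j _; rewrite fD; ring.
move=> i; rewrite inE => /predU1P[->|/c0//].
have := rel0 0 0; rewrite big_cons big_seq big1 => [|j /c0 ->]; last first.
  by rewrite mul0r.
by rewrite !mulr0 !addr0 cis0 mulr1.
Qed.

End UnitCircle.

(** * Characters of U(2) and the fusion rules *)

Section Fusion.
Variable R : realType.
Implicit Types (l d : int * int) (mu nu : weight) (w z : R[i]).

(* The formula of [chi] at an arbitrary weight; it vanishes on the wall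
   [l.2 = l.1 + 1], so the fusion rule needs no case distinction there. *)
Definition chi_ext l w1 w2 : R[i] :=
  if w1 == w2 then (l.1 - l.2 + 1)%:~R * w1 ^ (l.1 + l.2)
  else (w1 ^ (l.1 + 1) * w2 ^ l.2 - w1 ^ l.2 * w2 ^ (l.1 + 1)) / (w1 - w2).

Lemma chiE mu : chi mu = chi_ext (val mu).
Proof. by []. Qed.

Lemma chi_ext_wall l w1 w2 : l.2 = l.1 + 1 -> chi_ext l w1 w2 = 0.
Proof.
move=> lE; rewrite /chi_ext; case: eqP => _.
  by rewrite lE opprD addNKr addNr mul0r.
by rewrite lE subrr mul0r.
Qed.

Lemma chi_rho1 w1 w2 : chi rho1 w1 w2 = w1 + w2.
Proof.
rewrite chiE /chi_ext /=; have [->|w12] := eqVneq w1 w2.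
  by rewrite mulrDl mul1r.
rewrite !expr0z mulr1 mul1r (_ : 1 + 1 = 2%:Z) // -!exprnP subr_sqr.
by rewrite mulrAC divff ?mul1r // subr_eq0.
Qed.

Lemma chi_rho2 w1 w2 : chi rho2 w1 w2 = w1 * w2.
Proof.
rewrite chiE /chi_ext /=; have [->|w12] := eqVneq w1 w2.
  by rewrite subrr add0r mul1r (_ : 1 + 1 = 2%:Z).
rewrite !expr1z (_ : 1 + 1 = 2%:Z) // -!exprnP.
rewrite (_ : _ - _ = w1 * w2 * (w1 - w2)); last by ring.
by rewrite mulfK // subr_eq0.
Qed.

(** Multiplying the alternating numerator by w1 + w2 raises one of its two exponents. On the
    diagonal, with d = l.1 - l.2, the identity becomes 2 (d + 1) = (d + 2) + d. *)
Lemma chi_rho1M l w1 w2 : w1 != 0 -> w2 != 0 ->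
  chi rho1 w1 w2 * chi_ext l w1 w2 =
  chi_ext (l + (1, 0)) w1 w2 + chi_ext (l + (0, 1)) w1 w2.
Proof.
move=> w10 w20; rewrite chi_rho1 /chi_ext; case: l => a b /=.
case: eqVneq => [<-|w12].
  rewrite !addr0 (_ : a + 1 + b = a + b + 1); last by ring.
  rewrite (_ : a + (b + 1) = a + b + 1) ?addrA //.
  rewrite (expfzDr _ 1) // expr1z.
  by rewrite !(rmorphD, rmorphB) /=; ring.
rewrite -mulrDl mulrA; congr (_ / _).
by rewrite !addr0 !expfzDr // !expr1z; ring.
Qed.

Lemma chi_rho2M l w1 w2 : w1 != 0 -> w2 != 0 ->
  chi rho2 w1 w2 * chi_ext l w1 w2 = chi_ext (l + (1, 1)) w1 w2.
Proof.
move=> w10 w20; rewrite chi_rho2 /chi_ext; case: l => a b /=.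
case: eqVneq => [<-|w12].
  rewrite (_ : a + 1 + (b + 1) = (a + b) + 1 + 1); last by ring.
  rewrite (expfzDr _ 1) // (expfzDr _ 1) // expr1z.
  by rewrite !(rmorphD, rmorphB) /=; ring.
rewrite mulrA; congr (_ / _).
by rewrite !expfzDr // !expr1z; ring.
Qed.

(** Multiplication by w1 - w2 turns each character into a difference of two exponentials, also on
    the diagonal, where both sides vanish. Dominance makes all these exponents distinct: the larger
    entry comes first in one term and second in the other, which the boolean tag records. *)
Lemma chi_independent (r : seq weight) (c : weight -> R[i]) : uniq r ->
  (forall w1 w2, unit_circle w1 -> unit_circle w2 ->
     \sum_(nu <- r) c nu * chi nu w1 w2 = 0) ->
  {in r, forall nu, c nu = 0}.
Proof.
move=> ur rel0.
pose e (i : bool * weight) : int * int :=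
  if i.1 then ((val i.2).1 + 1, (val i.2).2)
  else ((val i.2).2, (val i.2).1 + 1).
pose c' (i : bool * weight) := if i.1 then c i.2 else - c i.2.
have inje : injective e.
  move=> [b [[l1 l2] /= l12]] [b' [[l1' l2'] /= l12']]; rewrite /e /=.
  case: b; case: b' => -[E1 E2].
  - by congr pair; apply: val_inj => /=; congr pair; lia.
  - lia.
  - lia.
  - by congr pair; apply: val_inj => /=; congr pair; lia.
have u2 : uniq [seq (b, nu) | b <- [:: true; false], nu <- r].
  by apply: allpairs_uniq => // -[? ?] [? ?].
have H := @cis_independent R _ _ e c' u2 (in2W inje).
move=> nu nur; suff: c' (true, nu) = 0 by [].
apply: H; last first.
  by apply/allpairsP; exists (true, nu).
move=> s t; rewrite /= cats0 big_cat /= !big_map /= /c' /e /=.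
rewrite -big_split /=.
have := rel0 _ _ (unit_circle_cis s) (unit_circle_cis t).
have termE w1 w2 nu' : c nu' * chi nu' w1 w2 * (w1 - w2) = c nu' *
    (w1 ^ ((val nu').1 + 1) * w2 ^ (val nu').2 -
     w1 ^ (val nu').2 * w2 ^ ((val nu').1 + 1)).
  rewrite -mulrA; congr (_ * _); rewrite chiE /chi_ext.
  case: eqVneq => [->|w12]; last by rewrite divfK // subr_eq0.
  by rewrite subrr mulr0 mulrC subrr.
move=> /(congr1 ( *%R^~ (cis s - cis t))); rewrite mul0r mulr_suml => E.
rewrite -[RHS]E; apply: eq_bigr => i _.
by rewrite termE !cisXz !cisD mulNr mulrBr.
Qed.

Lemma fusion_rule_unique rho (m m' : weight -> weight -> nat) :
  is_fusion_rule R rho m -> is_fusion_rule R rho m' -> m = m'.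
Proof.
move=> fm fm'; apply/funext => mu.
have [finS eS] := fm mu; have [finS' eS'] := fm' mu.
pose S := [set nu | m mu nu <> 0%N]; pose S' := [set nu | m' mu nu <> 0%N].
have finT : finite_set (S `|` S') by rewrite finite_setU.
pose r := finmap.enum_fset (fset_set (S `|` S')).
have rP nu : nu \in r = (nu \in S `|` S').
  by rewrite -(in_fset_set finT).
(* Both expansions are put over the union of their finite supports, so that independence applies to
   the differences of the coefficients. *)
have wide (n : weight -> weight -> nat) w1 w2 :
    [set nu | n mu nu <> 0%N] `<=` S `|` S' ->
    \sum_(nu \in [set nu | n mu nu <> 0%N]) (n mu nu)%:R * chi nu w1 w2 =
    \sum_(nu <- r) (n mu nu)%:R * chi nu w1 w2 :> R[i].
  move=> sub; rewrite (fsbig_widen _ (S `|` S')) ?fsbig_finite // => nu [_] /=.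
  by move=> /contrapT ->; rewrite mul0r.
have c0 : {in r, forall nu, (m mu nu)%:R - (m' mu nu)%:R = 0 :> R[i]}.
  apply: chi_independent => [|w1 w2 u1 u2]; first exact: finmap.fset_uniq.
  under eq_bigr do rewrite mulrBl.
  rewrite sumrB -!wide; [|exact: subsetUr|exact: subsetUl].
  by rewrite -eS // -eS' // subrr.
apply/funext => nu; have [nur|] := boolP (nu \in r).
  by have /eqP := c0 _ nur; rewrite subr_eq0 eqr_nat => /eqP.
by rewrite rP notin_setE /= => /not_orP[] /contrapT -> /contrapT ->.
Qed.

(** In both graphs an edge is a translation by one of finitely many vectors and no edge is repeated,
    so the list of vectors encodes the graph and both cases share the lemmas below. *)
Definition shift_mult (sh : seq (int * int)) mu nu : nat :=
  val nu - val mu \in sh.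

Definition shift_succ (sh : seq (int * int)) mu : seq weight :=
  pmap insub [seq val mu + d | d <- sh].

Definition shift_pred (sh : seq (int * int)) nu : seq weight :=
  pmap insub [seq val nu - d | d <- sh].

Lemma shift_succ_uniq (sh : seq (int * int)) mu : uniq sh -> uniq (shift_succ sh mu).
Proof. by move=> ?; apply: pmap_sub_uniq; rewrite map_inj_uniq //; exact: addrI. Qed.

Lemma shift_pred_uniq (sh : seq (int * int)) nu : uniq sh -> uniq (shift_pred sh nu).
Proof.
by move=> ?; apply: pmap_sub_uniq; rewrite map_inj_uniq // => x y /addrI /oppr_inj.
Qed.

Lemma mem_shift_succ sh mu nu :
  (nu \in shift_succ sh mu) = (shift_mult sh mu nu != 0%N).
Proof.
rewrite mem_pmap_sub /shift_mult eqb0 negbK.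
by rewrite -[X in X \in map _ _](subrKC (val mu)) (mem_map (@addrI _ (val mu))).
Qed.

Lemma mem_shift_pred sh mu nu :
  (mu \in shift_pred sh nu) = (shift_mult sh mu nu != 0%N).
Proof.
rewrite mem_pmap_sub /shift_mult eqb0 negbK.
rewrite -[X in X \in map _ _](subKr (val nu)).
by rewrite (mem_map (inj_comp (@addrI _ (val nu)) (@oppr_inj _))).
Qed.

Lemma big_shift (V : nmodType) (F : int * int -> V) (r : seq (int * int)) :
  \sum_(nu <- pmap (insub : _ -> option weight) r) F (val nu) =
  \sum_(l <- r | l.2 <= l.1) F l.
Proof.
rewrite -[LHS](big_map val xpredT F) (pmap_filter (insubK _)) big_filter.
by apply: eq_bigl => l; rewrite isSome_insub.
Qed.

(** The last hypothesis says that a shifted weight that is not dominant lies exactly on the wall,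
    where [chi_ext] vanishes; the terms dropped by [insub] are therefore zero. *)
Lemma shift_fusion (sh : seq (int * int)) rho : uniq sh ->
  (forall mu w1 w2, unit_circle w1 -> unit_circle w2 ->
     chi rho w1 w2 * chi mu w1 w2 =
     \sum_(d <- sh) chi_ext (val mu + d) w1 w2) ->
  (forall mu d, d \in sh -> (val mu + d).2 <= (val mu + d).1 + 1) ->
  fusion_mult R rho = shift_mult sh.
Proof.
move=> ush chiM dom.
have fs : is_fusion_rule R rho (shift_mult sh).
  move=> mu; have sE : [set nu | shift_mult sh mu nu <> 0%N] =
      [set` shift_succ sh mu].
    apply/seteqP; split => nu /=; rewrite mem_shift_succ; first by move/eqP.
    by move/eqP.
  rewrite sE; split; first exact: finite_seq.
  move=> w1 w2 u1 u2; rewrite -fsbig_seq ?shift_succ_uniq // chiM //.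
  transitivity (\sum_(nu <- shift_succ sh mu) chi_ext (val nu) w1 w2).
    rewrite (big_shift (fun l => chi_ext l w1 w2)) big_map [RHS]big_mkcond /=.
    rewrite big_seq [RHS]big_seq; apply: eq_bigr => d dsh.
    case: ifPn => // ndom; apply: chi_ext_wall.
    move: ndom (dom mu d dsh) => /=; lia.
  rewrite big_seq [RHS]big_seq; apply: eq_bigr => nu.
  by rewrite mem_shift_succ /shift_mult; case: (_ \in sh); rewrite // mul1r.
(* [xget] selects some fusion rule, since one has just been exhibited; uniqueness identifies it. *)
rewrite /fusion_mult; case: xgetP => [m -> fm|/(_ (shift_mult sh))] //.
exact: fusion_rule_unique fm fs.
Qed.

Definition shifts1 : seq (int * int) := [:: (1, 0); (0, 1)].
Definition shifts2 : seq (int * int) := [:: (1, 1)].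

Lemma fusion_mult_rho1 : fusion_mult R rho1 = shift_mult shifts1.
Proof.
apply: shift_fusion => // [mu w1 w2 /unit_circle_neq0 u1 /unit_circle_neq0 u2|].
  by rewrite chiE chi_rho1M // !big_cons big_nil addr0.
move=> [[l1 l2] /= l12] d; rewrite !inE => /orP[]/eqP -> /=; lia.
Qed.

Lemma fusion_mult_rho2 : fusion_mult R rho2 = shift_mult shifts2.
Proof.
apply: shift_fusion => // [mu w1 w2 /unit_circle_neq0 u1 /unit_circle_neq0 u2|].
  by rewrite chiE chi_rho2M // big_cons big_nil addr0.
move=> [[l1 l2] /= l12] d; rewrite !inE => /eqP -> /=; lia.
Qed.

End Fusion.

(** * Enumeration and counting of pairs of paths *)

Lemma card_eq_seq (T : choiceType) (r : seq T) : uniq r -> ([set` r] #= `I_(size r))%card.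
Proof.
move=> ur; have -> : [set` r] = [set` [fset x | x in r]%fset].
  by apply/seteqP; split => x /=; rewrite !inE.
by apply/card_eq_fsetP; rewrite card_fseq undup_id.
Qed.

Section PathCount.
Variables (V : choiceType) (mult : V -> V -> nat) (succ pred : V -> seq V).
Hypothesis succ_uniq : forall x, uniq (succ x).
Hypothesis pred_uniq : forall x, uniq (pred x).
Hypothesis mem_succ : forall x y, (y \in succ x) = (mult x y != 0%N).
Hypothesis mem_pred : forall x y, (x \in pred y) = (mult x y != 0%N).
Variable x0 : V.
Implicit Types (x y : V) (m n : nat).

Let edge := edge mult.

Definition out_edges x : seq edge :=
  [seq existT (fun xy : V * V => 'I_(mult xy.1 xy.2)) (x, y) i |
    y <- succ x, i <- enum 'I_(mult x y)].

Definition in_edges y : seq edge :=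
  [seq existT (fun xy : V * V => 'I_(mult xy.1 xy.2)) (x, y) i |
    x <- pred y, i <- enum 'I_(mult x y)].

Lemma mem_out_edges x (e : edge) : (e \in out_edges x) = (source e == x).
Proof.
apply/allpairsPdep/eqP => [[y [i [_ _ ->]]] //|].
case: e => -[x' y] /= i; rewrite /source /= => <-; exists y, i.
(* The label of the edge is an element of ['I_(mult x' y)], so the multiplicity is not zero. *)
by rewrite mem_succ mem_enum; split => //; case: (mult x' y) i => // -[].
Qed.

Lemma mem_in_edges y (e : edge) : (e \in in_edges y) = (target e == y).
Proof.
apply/allpairsPdep/eqP => [[x [i [_ _ ->]]] //|].
case: e => -[x y'] /= i; rewrite /target /= => <-; exists x, i.
by rewrite mem_pred mem_enum; split => //; case: (mult x y') i => // -[].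
Qed.

Lemma out_edges_uniq x : uniq (out_edges x).
Proof.
apply: allpairs_uniq_dep => // [y _|]; first exact: enum_uniq.
move=> [y i] [y' i'] _ _ /= E; have [Ey] := congr1 tag E.
by move: i i' E; rewrite -Ey => i i' /eqP; rewrite eq_Tagged /= => /eqP ->.
Qed.

Lemma in_edges_uniq y : uniq (in_edges y).
Proof.
apply: allpairs_uniq_dep => // [x _|]; first exact: enum_uniq.
move=> [x i] [x' i'] _ _ /= E; have [Ex] := congr1 tag E.
by move: i i' E; rewrite -Ex => i i' /eqP; rewrite eq_Tagged /= => /eqP ->.
Qed.

(** Explicit duplicate-free lists give the finiteness of [path_pairs] and its cardinal at once. *)
Fixpoint returns n x : seq (seq edge) :=
  if n is n'.+1 then [seq e :: p | e <- in_edges x, p <- returns n' (source e)]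
  else if x == x0 then [:: [::]] else [::].

Fixpoint trips m n x : seq (seq edge * seq edge) :=
  if m is m'.+1 then
    [seq (e :: pq.1, pq.2) | e <- out_edges x, pq <- trips m' n (target e)]
  else [seq ([::], q) | q <- returns n x].

Lemma returnsP n x (p : seq edge) :
  p \in returns n x <-> size p = n /\ is_path (@target _ mult) (@source _ mult) x p x0.
Proof.
elim: n x p => [|n IH] x p /=.
  case: eqVneq => [->|xx0]; rewrite ?inE.
    by split => [/eqP ->|[/size0nil ->]].
  by split => // -[/size0nil -> /= /eqP]; rewrite (negPf xx0).
split.
  move=> /allpairsPdep[e [q [ex /IH[<- pq] ->]]]; split => //=.
  by split => //; apply/eqP; rewrite -mem_in_edges.
case: p => [[]//|e q /= [[sq] [te pq]]].
apply/allpairsPdep; exists e, q; split => //; last exact/IH.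
by rewrite mem_in_edges te.
Qed.

Lemma tripsP m n x (pq : seq edge * seq edge) :
  pq \in trips m n x <-> [/\ size pq.1 = m, size pq.2 = n &
    exists y, is_path (@source _ mult) (@target _ mult) x pq.1 y /\
              is_path (@target _ mult) (@source _ mult) y pq.2 x0].
Proof.
elim: m x pq => [|m IH] x [p q] /=.
  split => [/mapP[q' /returnsP[sq pq] [-> ->]]|].
    by split => //; exists x.
  case=> /size0nil -> sq [y [/= <- pq]]; apply: map_f; exact/returnsP.
split.
  move=> /allpairsPdep[e [[p' q'] [ex /IH[/= <- <- [y pq]] [-> ->]]]]; split => //=.
  exists y; case: pq => ? ?; split => //; split => //.
  by apply/eqP; rewrite -mem_out_edges.
case: p => [[]//|e p' /= [[sp] sq [y [[se pp] pq]]]].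
apply/allpairsPdep; exists e, (p', q); split => //.
  by rewrite mem_out_edges se.
by apply/IH; split => //; exists y.
Qed.

Lemma returns_uniq n x : uniq (returns n x).
Proof.
elim: n x => [|n IH] x /=; first by case: ifP.
apply: allpairs_uniq_dep => //; first exact: in_edges_uniq.
by move=> [e p] [e' p'] _ _ /= [-> ->].
Qed.

Lemma trips_uniq m n x : uniq (trips m n x).
Proof.
elim: m x => [|m IH] x /=.
  by rewrite map_inj_uniq ?returns_uniq // => ? ? [].
apply: allpairs_uniq_dep => //; first exact: out_edges_uniq.
by move=> [e [p q]] [e' [p' q']] _ _ /= [-> -> ->].
Qed.

(** An entry of the [n]-th power of the adjacency matrix: following edges backwards from [x] to [x0]
    is the same as following them forwards from [x0] to [x]. *)
Fixpoint nb_returns n x : nat :=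
  if n is n'.+1 then (\sum_(y <- pred x) mult y x * nb_returns n' y)%N
  else x == x0.

Fixpoint nb_trips m n x : nat :=
  if m is m'.+1 then (\sum_(y <- succ x) mult x y * nb_trips m' n y)%N
  else nb_returns n x.

Lemma size_returns n x : size (returns n x) = nb_returns n x.
Proof.
elim: n x => [|n IH] x /=; first by case: ifP.
rewrite size_allpairs_dep sumnE big_map big_allpairs_dep.
apply: eq_bigr => y _; rewrite (eq_bigr (fun=> nb_returns n y)).
  by rewrite big_const_seq count_predT size_enum_ord iter_addn_0 mulnC.
by move=> i _; rewrite IH.
Qed.

Lemma size_trips m n x : size (trips m n x) = nb_trips m n x.
Proof.
elim: m x => [|m IH] x /=; first by rewrite size_map size_returns.
rewrite size_allpairs_dep sumnE big_map big_allpairs_dep.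
apply: eq_bigr => y _; rewrite (eq_bigr (fun=> nb_trips m n y)).
  by rewrite big_const_seq count_predT size_enum_ord iter_addn_0 mulnC.
by move=> i _; rewrite IH.
Qed.

Lemma card_path_pairs m n :
  (path_pairs mult x0 m n #= `I_(nb_trips m n x0))%card.
Proof.
rewrite -size_trips.
have -> : path_pairs mult x0 m n = [set` trips m n x0].
  by apply/seteqP; split => pq /=; rewrite tripsP.
exact/card_eq_seq/trips_uniq.
Qed.

End PathCount.

(** * Elementary trigonometric integrals *)

Section TrigIntegrals.
Variable R : realType.
Notation mu := (@lebesgue_measure R).
Implicit Types (f F : R -> R) (a b c t : R) (j d n : nat).

Lemma Rintegral_FTC f F a b : a < b -> continuous f ->
  (forall x : R, is_derive x 1 F (f x)) ->
  \int[mu]_(x in `[a, b]) f x = F b - F a.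
Proof.
move=> ab cf dF; rewrite /Rintegral.
have cF : continuous F.
  by move=> x; apply/differentiable_continuous/derivable1_diffP; case: (dF x).
rewrite (@continuous_FTC2 _ f F) //.
- exact: continuous_subspaceT.
- split => [x _||].
  + by case: (dF x).
  + exact/cvg_at_right_filter/cF.
  + exact/cvg_at_left_filter/cF.
- by move=> x _; rewrite derive1E; case: (dF x).
Qed.

Lemma continuous_itv_integrable f a b : continuous f ->
  mu.-integrable `[a, b] (EFin \o f).
Proof.
move=> cf; apply: continuous_compact_integrable; first exact: segment_compact.
exact: continuous_subspaceT.
Qed.

Lemma continuous_sinM c : continuous (fun t : R => sin (c * t)).
Proof.
move=> t; apply: (@continuous_comp _ _ _ ( *%R c) sin).
  exact: mulrl_continuous.
exact: continuous_sin.
Qed.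

Lemma continuous_cosM c : continuous (fun t : R => cos (c * t)).
Proof.
move=> t; apply: (@continuous_comp _ _ _ ( *%R c) cos).
  exact: mulrl_continuous.
exact: continuous_cos.
Qed.

Lemma is_derive_sinM c t : is_derive t 1 (fun t => sin (c * t)) (c * cos (c * t)).
Proof.
have H : is_derive t 1 ( *%R c) c.
  by have := is_deriveZ c (is_derive_id t (1 : R)); rewrite /GRing.scale /= mulr1.
have := @is_derive1_comp R sin ( *%R c) t _ _ (is_derive_sin _) H.
by rewrite mulrC.
Qed.

Lemma is_derive_cosM c t : is_derive t 1 (fun t => cos (c * t)) (- c * sin (c * t)).
Proof.
have H : is_derive t 1 ( *%R c) c.
  by have := is_deriveZ c (is_derive_id t (1 : R)); rewrite /GRing.scale /= mulr1.
have := @is_derive1_comp R cos ( *%R c) t _ _ (is_derive_cos _) H.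
by rewrite mulrC mulrN mulNr.
Qed.

Lemma Rintegral_cosM c a b : c != 0 -> a < b ->
  \int[mu]_(t in `[a, b]) cos (c * t) = c^-1 * (sin (c * b) - sin (c * a)).
Proof.
move=> c0 ab; rewrite mulrBr.
apply: (@Rintegral_FTC _ (fun t => c^-1 * sin (c * t)) _ _ ab).
  exact: continuous_cosM.
move=> x; have := is_deriveZ c^-1 (is_derive_sinM c x).
by rewrite /GRing.scale /= mulrA mulVf // mul1r.
Qed.

End TrigIntegrals.

(** * Chebyshev moments and the semicircle density *)

Section Semicircle.
Variable R : realType.
Notation mu := (@lebesgue_measure R).
Implicit Types (t : R) (j d n : nat).

Definition cheb_fun j d t : R := (2 * cos t) ^+ j * (sin (d.+1%:R * t) * sin t).

(* [sin ((d + 1) t) / sin t] is the character of the irreducible representation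
   of SU(2) of dimension [d + 1], [2 cos t] that of the defining one, and
   [(2 / pi) sin^2 t dt] on [0, pi] is Haar measure on conjugacy classes.  Half of the
   interval suffices when [j + d] is even, by the symmetry [t -> pi - t]. *)
Definition cheb_moment j d : R :=
  4 / pi * \int[mu]_(t in `[0, pi / 2]) cheb_fun j d t.

Lemma cheb_fun_continuous j d : continuous (cheb_fun j d).
Proof.
move=> t; apply: cvgM; last first.
  apply: cvgM; [exact: continuous_sinM|exact: continuous_sin].
apply: (@continuous_comp _ _ _ (fun t => 2 * cos t) (fun x => x ^+ j)).
  by apply: cvgM; [exact: cvg_cst|exact: continuous_cos].
exact: exprn_continuous.
Qed.

(** The recursion at the wall: sin (2 t) = 2 cos t sin t, so only one neighbour remains. *)
Lemma cheb_moment_rec0 j : cheb_moment j.+1 0 = cheb_moment j 1.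
Proof.
congr (_ * _); apply: eq_Rintegral => t _; rewrite /cheb_fun exprSr -!mulrA.
congr (_ * _); rewrite mul1r !mulrA; congr (_ * _).
rewrite [in RHS]mulr_natl mulr2n sinD; ring.
Qed.

Lemma cheb_moment_rec j d :
  cheb_moment j.+1 d.+1 = cheb_moment j d + cheb_moment j d.+2.
Proof.
rewrite /cheb_moment -mulrDr -RintegralD //; first last.
- exact/continuous_itv_integrable/cheb_fun_continuous.
- exact/continuous_itv_integrable/cheb_fun_continuous.
congr (_ * _); apply: eq_Rintegral => t _; rewrite /cheb_fun exprSr -!mulrA.
rewrite -mulrDr; congr (_ * _); rewrite !mulrA -mulrDl; congr (_ * _).
have -> : d.+1%:R * t = d.+2%:R * t - t by rewrite -[d.+2]addn1 natrD mulrDl mul1r addrK.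
have -> : d.+3%:R * t = d.+2%:R * t + t by rewrite -[d.+3]addn1 natrD mulrDl mul1r.
rewrite sinB sinD; ring.
Qed.

Lemma sin_natMpi n : sin (n%:R * pi) = 0 :> R.
Proof.
elim: n => [|n IH]; first by rewrite mul0r sin0.
by rewrite -addn1 natrD mulrDl mul1r sinDpi IH oppr0.
Qed.

(** The product of sines is half of cos (d t) - cos ((d + 2) t). For even d the primitives of the
    nonconstant cosines vanish at both 0 and pi / 2. For d = 0 the constant term contributes pi / 4,
    which the factor 4 / pi normalises. *)
Lemma cheb_moment0 d : ~~ odd d -> cheb_moment 0 d = (d == 0%N)%:R.
Proof.
move=> ed; have pi0 := pi_gt0 R; have pi20 : 0 < pi / 2 :> R by rewrite divr_gt0.
have sinh n : ~~ odd n -> sin (n%:R * (pi / 2)) = 0 :> R.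
  move=> en; rewrite -(even_halfK en) -muln2 natrM -mulrA.
  by rewrite [2 * _]mulrC divfK ?pnatr_eq0 // sin_natMpi.
pose f t : R := 2^-1 * (cos (d%:R * t) - cos (d.+2%:R * t)).
have fE : cheb_fun 0 d =1 f.
  move=> t; rewrite /cheb_fun /f expr0 mul1r.
  have -> : d%:R * t = d.+1%:R * t - t by rewrite -[d.+1]addn1 natrD mulrDl mul1r addrK.
  have -> : d.+2%:R * t = d.+1%:R * t + t by rewrite -[d.+2]addn1 natrD mulrDl mul1r.
  by rewrite cosB cosD; field.
rewrite /cheb_moment.
under eq_Rintegral do rewrite fE /f.
have ci n : mu.-integrable `[0, pi / 2] (EFin \o (fun t : R => cos (n%:R * t))).
  exact/continuous_itv_integrable/continuous_cosM.
rewrite RintegralZl //; last first.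
  apply: continuous_itv_integrable => t.
  by apply: cvgB; apply: continuous_cosM.
rewrite RintegralB // [X in _ - X]Rintegral_cosM ?pnatr_eq0 //.
rewrite mulr0 sin0 sinh /= ?negbK // subrr mulr0 subr0.
case: d => [|d] in ed f fE *.
  under eq_Rintegral do rewrite mul0r cos0.
  have muE : mu `[0, pi / 2]%classic = (pi / 2)%:E.
    by rewrite lebesgue_measure_itv /= lte_fin pi20 -EFinD subr0.
  rewrite Rintegral_cst // mul1r; move: muE => /= ->.
  have cancel_pi (x : R) : x != 0 -> 4 / x * (2^-1 * (x / 2)) = 1 by move=> ?; field.
  by rewrite cancel_pi // gt_eqF.
by rewrite (@Rintegral_cosM _ d.+1%:R) ?pnatr_eq0 // mulr0 sin0 sinh // subrr !mulr0.
Qed.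

(** Under r = 2 cos t both the square root and -dr / dt become 2 sin t, as sin is nonnegative on
    [0, pi / 2]. Their product contributes a factor 4, of which pi remains beside the normalisation
    4 / pi. *)
Lemma Rintegral_semicircle_moment n :
  \int[mu]_(r in `[0, 2]) (r ^+ n.*2 * Num.sqrt (4 - r ^+ 2)) =
  pi * cheb_moment n.*2 0.
Proof.
have pi0 := pi_gt0 R; have pi20 : 0 < pi / 2 :> R by rewrite divr_gt0.
pose F t : R := 2 * cos t.
have dF t : is_derive t 1 F (- (2 * sin t)).
  by have := is_deriveZ 2 (is_derive_cos t); rewrite /GRing.scale /= mulrN.
have F'E : F^`()%classic = fun t => - (2 * sin t).
  by apply/funext => t; rewrite derive1E; case: (dF t).
have F'c : continuous (F^`()%classic : R -> R).
  rewrite F'E => t; apply: cvgN; apply: cvgM; first exact: cvg_cst.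
  exact: continuous_sin.
have cF : continuous F.
  by move=> t; apply: cvgM; [exact: cvg_cst|exact: continuous_cos].
have F0 : F 0 = 2 by rewrite /F cos0 mulr1.
have Fp : F (pi / 2) = 0 by rewrite /F cos_pihalf mulr0.
(* The bounds 0 and 2 are written as [F (pi / 2)] and [F 0], the form required by substitution along
   a decreasing map. *)
rewrite {1}/Rintegral -{1}F0 -{1}Fp.
rewrite (@integration_by_substitution_decreasing _ F
  (fun r => r ^+ n.*2 * Num.sqrt (4 - r ^+ 2))).
- rewrite /cheb_moment mulrA (_ : pi * (4 / pi) = 4); last first.
    by rewrite mulrC divfK // gt_eqF.
  rewrite -RintegralZl //; last exact/continuous_itv_integrable/cheb_fun_continuous.
  apply: eq_Rintegral => t; rewrite inE => /andP[t0 tp].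
  rewrite bnd_simp in t0; rewrite bnd_simp in tp.
  rewrite F'E !fctE /= /cheb_fun mul1r.
  have s0 : 0 <= sin t by apply: sin_ge0_pi; rewrite t0 /=; lra.
  have -> : 4 - F t ^+ 2 = (2 * sin t) ^+ 2.
    by rewrite /F !exprMn sin2cos2; ring.
  rewrite sqrtr_sqr ger0_norm ?mulr_ge0 // /F opprK; ring.
- exact: ltW.
- move=> x y; rewrite !in_itv /= => /andP[x0 xp] /andP[y0 yp] xy.
  rewrite /F ltr_pM2l // ltr_cos // in_itv /=; lra.
- by move=> x _; exact: F'c.
- by apply/cvg_ex; exists (F^`()%classic 0); apply: cvg_at_right_filter; exact: F'c.
- by apply/cvg_ex; exists (F^`()%classic (pi / 2)); apply: cvg_at_left_filter; exact: F'c.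
- split; first by move=> t _; case: (dF t).
    by apply: cvg_at_right_filter; exact: cF.
  by apply: cvg_at_left_filter; exact: cF.
- apply: continuous_subspaceT => r; apply: cvgM; first exact: exprn_continuous.
  apply: (@continuous_comp _ _ _ (fun r : R => 4 - r ^+ 2) Num.sqrt).
    by apply: cvgB; [exact: cvg_cst|exact: exprn_continuous].
  exact: sqrt_continuous.
Qed.

End Semicircle.

(** * Solving the path recursions *)

Section WeightPaths.
Variable R : realType.
Implicit Types (l d : int * int) (x y : weight) (m n : nat).

Section Shifts.
Variable sh : seq (int * int).
Local Notation nb_returns := (nb_returns (shift_mult sh) (shift_pred sh) weight0).
Local Notation nb_trips :=
  (nb_trips (shift_mult sh) (shift_succ sh) (shift_pred sh) weight0).

(** The candidate [g] lives on the whole lattice, so that it can be a closed formula; only the sum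
    in its recursion is restricted to dominant weights. *)
Lemma nb_returnsE (g : nat -> int * int -> R) :
  (forall x, g 0%N (val x) = (x == weight0)%:R) ->
  (forall n x, g n.+1 (val x) =
     \sum_(d <- sh | (val x - d).2 <= (val x - d).1) g n (val x - d)) ->
  forall n x, (nb_returns n x)%:R = g n (val x).
Proof.
move=> g0 gS; elim=> [|n IH] x /=; first by rewrite g0.
rewrite natr_sum gS -(big_map (fun d => val x - d) (fun l => l.2 <= l.1) (g n)).
rewrite -big_shift big_seq [RHS]big_seq; apply: eq_bigr => y.
rewrite mem_shift_pred natrM IH /shift_mult; case: (_ \in sh) => // _.
by rewrite mul1r.
Qed.

Lemma nb_tripsE (g : nat -> nat -> int * int -> R) :
  (forall n x, g 0%N n (val x) = (nb_returns n x)%:R) ->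
  (forall m n x, g m.+1 n (val x) =
     \sum_(d <- sh | (val x + d).2 <= (val x + d).1) g m n (val x + d)) ->
  forall m n x, (nb_trips m n x)%:R = g m n (val x).
Proof.
move=> g0 gS; elim=> [|m IH] n x /=; first by rewrite g0.
rewrite natr_sum gS -(big_map (fun d => val x + d) (fun l => l.2 <= l.1) (g m n)).
rewrite -big_shift big_seq [RHS]big_seq; apply: eq_bigr => y.
rewrite mem_shift_succ natrM IH /shift_mult; case: (_ \in sh) => // _.
by rewrite mul1r.
Qed.

End Shifts.

Lemma nb_trips_shifts1 m n :
  (nb_trips (shift_mult shifts1) (shift_succ shifts1) (shift_pred shifts1)
     weight0 m n weight0)%:R =
  (if m == n then cheb_moment R (m + n) 0 else 0).
Proof.
(* Both kinds of steps change [l.1 - l.2] by one; the total degree [l.1 + l.2]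
   only forces the numbers of forward and backward steps to match. *)
pose g m n (l : int * int) : R :=
  if l.1 + l.2 + m%:Z == n%:Z then cheb_moment R (m + n) (absz (l.1 - l.2)%R) else 0.
(* The test [0 < k] merges the recursion in the interior with the one at the wall. *)
have step j (k : int) : 0 <= k -> cheb_moment R j.+1 (absz k) =
    cheb_moment R j (absz (k + 1)%R) +
    (if 0 < k then cheb_moment R j (absz (k - 1)%R) else 0).
  case: k => [[|k]|//] _.
    by rewrite cheb_moment_rec0 /= addr0.
  rewrite cheb_moment_rec addrC; congr (cheb_moment R j _ + _).
    by lia.
  by rewrite /=; congr cheb_moment; lia.
rewrite (@nb_tripsE shifts1 g) => [|{m}{}n x|{m}{}n m x].
- rewrite /g /=.
  by rewrite !add0r eqz_nat.
- rewrite (@nb_returnsE shifts1 (g 0%N)) // => {n x} [x|n x].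
    case: x => -[l1 l2] /= l12; rewrite /g -(inj_eq val_inj) /= addr0.
    rewrite -pair_eqE /= /pair_eq /=.
    case: eqP => [l0|l0]; last by case: eqP => //; case: eqP => //; lia.
    (* Here l1 + l2 = 0, so l1 - l2 is even, as the evaluation at length zero demands. *)
    rewrite addn0 cheb_moment0; last by lia.
    by congr (_%:R); lia.
  case: x => -[l1 l2] /= l12; rewrite /g !big_cons big_nil /= !subr0 !addr0.
  rewrite (_ : l2 - 1 <= l1) /=; last by lia.
  have -> : (l1 - 1 + l2 == n) = (l1 + l2 == n.+1) by lia.
  have -> : (l1 + (l2 - 1) == n) = (l1 + l2 == n.+1) by lia.
  case: ifP => _; last by rewrite addr0; case: ifP.
  rewrite !add0n step; last by lia.
  rewrite addrC (_ : l1 - l2 + 1 = l1 - (l2 - 1)); last by ring.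
  rewrite (_ : l1 - l2 - 1 = l1 - 1 - l2); last by ring.
  rewrite (_ : (0 < l1 - l2) = (l2 <= l1 - 1)); last by lia.
  by case: ifP; rewrite ?addr0 ?add0r.
- case: x => -[l1 l2] /= l12; rewrite /g !big_cons big_nil /= !addr0.
  rewrite (_ : l2 <= l1 + 1) /=; last by lia.
  have -> : (l1 + 1 + l2 + n == m) = (l1 + l2 + n.+1 == m) by lia.
  have -> : (l1 + (l2 + 1) + n == m) = (l1 + l2 + n.+1 == m) by lia.
  case: ifP => _; last by rewrite add0r; case: ifP.
  rewrite addSn step; last by lia.
  rewrite (_ : l1 - l2 + 1 = l1 + 1 - l2); last by ring.
  rewrite (_ : l1 - l2 - 1 = l1 - (l2 + 1)); last by ring.
  rewrite (_ : (0 < l1 - l2) = (l2 + 1 <= l1)); last by lia.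
  by case: ifP; rewrite ?addr0.
Qed.

Lemma nb_trips_shifts2 m n :
  (nb_trips (shift_mult shifts2) (shift_succ shifts2) (shift_pred shifts2)
     weight0 m n weight0)%:R = (m == n)%:R :> R.
Proof.
(* After m steps by (1, 1) and n steps back, the walk from l is at l + (m - n, m - n); it closes up
   when this is the origin. *)
pose g m n (l : int * int) : R := (l == ((n%:Z - m%:Z), (n%:Z - m%:Z)))%:R.
rewrite (@nb_tripsE shifts2 g) => [|{m}{}n x|{m}{}n m x].
- by rewrite /g -pair_eqE /= /pair_eq /=; congr (_%:R); lia.
- rewrite (@nb_returnsE shifts2 (g 0%N)) // => {n x} n x.
  case: x => -[l1 l2] /= l12; rewrite /g big_cons big_nil /= ?addr0.
  rewrite (_ : l2 - 1 <= l1 - 1); last by lia.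
  by rewrite -!pair_eqE /= /pair_eq /=; rewrite ?addr0; congr (_%:R); lia.
- case: x => -[l1 l2] /= l12; rewrite /g big_cons big_nil /= ?addr0.
  rewrite (_ : l2 + 1 <= l1 + 1); last by lia.
  by rewrite -!pair_eqE /= /pair_eq /=; rewrite ?addr0; congr (_%:R); lia.
Qed.

End WeightPaths.

(** * Probabilities given by a density *)

Section Density.
Context d (T : measurableType d) (R : realType).
Implicit Types (P : probability T R) (u w : T -> R).

(** Meant for monomials, which are unbounded on the plane but bounded on the support of the
    measure. *)
Lemma bounded_off_null_integrable P (N : set T) u (C : R) :
  measurable N -> P N = 0%E -> measurable_fun setT u ->
  (forall x, ~ N x -> `|u x| <= C) -> P.-integrable setT (EFin \o u).
Proof.
move=> mN PN mu ub; apply/(negligible_integrable mN) => //.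
  exact/measurable_EFinP.
have mCN : measurable (setT `\` N) by exact: measurableD.
apply: (@le_integrable _ _ _ P _ mCN _ (EFin \o cst C)).
- exact/measurable_EFinP/measurable_funTS.
- by move=> x [_ /ub]; rewrite /= lee_fin => /le_trans; apply; exact: ler_norm.
- exact: finite_measure_integrable_cst.
Qed.

Variable mu : {sigma_finite_measure set T -> \bar R}.

Section DensityProbability.
Variable w : T -> R.
Hypothesis w_ge0 : forall x, 0 <= w x.
Hypothesis mw : measurable_fun setT w.
Hypothesis w1 : (\int[mu]_x (w x)%:E)%E = 1%E.

Let P0 (A : set T) : \bar R := (\int[mu]_(x in A) (w x)%:E)%E.

Let mEw : measurable_fun setT (EFin \o w).
Proof. exact/measurable_EFinP. Qed.

Let P00 : P0 set0 = 0%E.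
Proof. by rewrite /P0 integral_set0. Qed.

Let P0_ge0 A : (0 <= P0 A)%E.
Proof. by apply: integral_ge0 => x _; rewrite lee_fin. Qed.

Let P0_sigma : semi_sigma_additive P0.
Proof. by apply: semi_sigma_additive_nng_induced => // x; rewrite lee_fin. Qed.

HB.instance Definition _ := isMeasure.Build _ _ _ P0 P00 P0_ge0 P0_sigma.
HB.instance Definition _ := Measure_isProbability.Build _ _ R P0 w1.

Lemma density_probability : exists P, forall A, measurable A ->
  P A = (\int[mu]_(x in A) (w x)%:E)%E.
Proof. by exists (P0 : probability T R). Qed.

End DensityProbability.

(** The change of variables is available for the Radon-Nikodym derivative; it agrees almost
    everywhere with [w], since both have the same integral over every measurable set. *)
Lemma integral_density P w u : (forall x, 0 <= w x) -> measurable_fun setT w ->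
  (forall A, measurable A -> P A = (\int[mu]_(x in A) (w x)%:E)%E) ->
  P.-integrable setT (EFin \o u) ->
  (\int[P]_x (u x)%:E = \int[mu]_x (u x * w x)%:E)%E.
Proof.
move=> w0 mw PE iu.
have mEw : measurable_fun setT (EFin \o w) by exact/measurable_EFinP.
have PmuD : P `<< mu.
  apply/null_content_dominatesP => A mA muA; rewrite PE //.
  by apply: null_set_integral => //; exact: measurable_funTS.
have iw : mu.-integrable setT (EFin \o w).
  apply/integrableP; split => //; under eq_integral do rewrite /= ger0_norm //.
  by rewrite -PE // probability_setT ltry.
rewrite -(Radon_Nikodym_change_of_variables PmuD measurableT iu).
apply: ae_eq_integral => //.
- apply: emeasurable_funM; first exact: measurable_int iu.
  exact: measurable_int (Radon_Nikodym_integrable _).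
- under eq_fun do rewrite EFinM.
  by apply: emeasurable_funM => //; exact: measurable_int iu.
under [X in ae_eq _ _ _ X]eq_fun do rewrite EFinM.
apply: ae_eqe_mul2l; apply: integral_ae_eq => //.
  exact: Radon_Nikodym_integrable.
move=> E _ mE; rewrite -Radon_Nikodym_integral //.
exact: PE.
Qed.

End Density.

(** * Integrals of products over the plane *)

Section ProductIntegral.
Variable R : realType.
Local Notation lam := (@lebesgue_measure R).

(* The sigma-finiteness of a product measure is not inferred for a product of
   measures that are not sub-probabilities. *)
Definition lebesgue2 := (lam \x lam)%E.

HB.instance Definition _ := Measure.on lebesgue2.

Let lebesgue2_sigma_finite : sigma_finite setT lebesgue2.
Proof.
have /sigma_finiteP[F [TF ndF Foo]] := sigma_finiteT lam.
exists (fun n => F n `*` F n) => [|n].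
  apply/esym/seteqP; split => // -[x y] _.
  have [[k _ Fx] [l _ Fy]] : (\bigcup_n F n) x /\ (\bigcup_n F n) y by rewrite -TF.
  (* The two coordinates may enter the exhaustion at different stages; monotonicity provides a
     common one. *)
  exists (maxn k l) => //; split.
    exact: (subsetPset _ _ (ndF _ _ (leq_maxl k l))).
  exact: (subsetPset _ _ (ndF _ _ (leq_maxr k l))).
have [mF Fn] := Foo n; split; first exact: measurableX.
by rewrite /lebesgue2 product_measure1E // lte_mul_pinfty // ge0_fin_numE.
Qed.

HB.instance Definition _ :=
  Measure_isSigmaFinite.Build _ _ _ lebesgue2 lebesgue2_sigma_finite.

Lemma integral_prodM (u v : R -> R) :
  lam.-integrable setT (EFin \o u) -> lam.-integrable setT (EFin \o v) ->
  (\int[lebesgue2]_p (u p.1 * v p.2)%:E =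
   (\int[lam]_x u x * \int[lam]_x v x)%:E)%E.
Proof.
move=> iu iv.
have mu := measurable_int _ iu; have mv := measurable_int _ iv.
have muR : measurable_fun setT u by exact/measurable_EFinP.
have mvR : measurable_fun setT v by exact/measurable_EFinP.
have muv : measurable_fun setT (fun p : R * R => (u p.1 * v p.2)%:E).
  apply/measurable_EFinP; apply: measurable_funM.
    by apply: measurableT_comp => //; exact: measurable_fst.
  by apply: measurableT_comp => //; exact: measurable_snd.
(* Fubini needs joint integrability, obtained from the iterated integral of the absolute value,
   which factors. *)
have iuv : (lam \x lam)%E.-integrable setT (fun p : R * R => (u p.1 * v p.2)%:E).
  apply/integrable12ltyP => //=.
  have -> : (fun x => \int[lam]_y `|(u x * v y)%:E|)%E =
      (fun x => `|(u x)%:E| * \int[lam]_y `|(v y)%:E|)%E.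
    apply/funext => x; under eq_integral do rewrite EFinM abseM.
    rewrite ge0_integralZl //.
    exact: measurableT_comp.
  have /integrableP[_ fv] := iv; have /integrableP[_ fu] := iu.
  rewrite ge0_integralZr //; last 2 first.
  - exact: measurableT_comp.
  - exact: integral_ge0.
  by rewrite lte_mul_pinfty // ?integral_ge0 // ge0_fin_numE // integral_ge0.
have finu := integrable_fin_num measurableT iu.
have finv := integrable_fin_num measurableT iv.
rewrite -integral12_prod_meas1 //= /fubini_F /=.
have -> : (fun x => \int[lam]_y (u x * v y)%:E)%E =
    (fun x => (u x)%:E * (\int[lam]_y v y)%:E)%E.
  apply/funext => x; under eq_integral do rewrite EFinM.
  rewrite integralZl // /Rintegral fineK //.
rewrite integralZr // /Rintegral EFinM; congr (_ * _)%E.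
by rewrite fineK.
Qed.

End ProductIntegral.

(** * Polynomial approximation of a step function *)

Section StepApproximation.
Variable R : realType.
Implicit Types (x y p : R) (n k : nat).

Lemma bernoulli_inequality x n : -1 <= x -> 1 + n%:R * x <= (1 + x) ^+ n.
Proof.
move=> x1; elim: n => [|n IH]; first by rewrite mul0r addr0 expr0.
rewrite exprS; apply: le_trans (ler_wpM2l _ IH); last by rewrite -lerBlDl sub0r.
rewrite -addn1 natrD; have := mulr_ge0 (ler0n R n) (sqr_ge0 x); nra.
Qed.

(** Put y = s^2. By Bernoulli, (1 + n (1 - s)) s^n <= ((2 - s) s)^n <= 1, so n s^n stays below 1 /
    (1 - s), and the other factor s^n tends to zero. *)
Lemma cvg_natM_geometric y : 0 <= y -> y < 1 ->
  n%:R * y ^+ n @[n --> \oo] --> (0 : R).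
Proof.
move=> y0 y1; pose s := Num.sqrt y.
have s0 : 0 <= s by exact: sqrtr_ge0.
have s1 : s < 1 by rewrite -sqrtr1 ltr_sqrt.
have sE : s ^+ 2 = y by rewrite sqr_sqrtr.
have ub n : n%:R * s ^+ n <= (1 - s)^-1.
  rewrite -[X in _ <= X]mul1r ler_pdivlMr ?subr_gt0 //.
  have h1 := bernoulli_inequality n (_ : -1 <= 1 - s).
  have e1 : s ^+ n <= 1 by rewrite exprn_ile1 // ltW.
  have : (1 + n%:R * (1 - s)) * s ^+ n <= (1 + (1 - s)) ^+ n * s ^+ n.
    by rewrite ler_wpM2r ?exprn_ge0 // h1 //; lra.
  rewrite -exprMn => h2.
  have h3 : ((1 + (1 - s)) * s) ^+ n <= 1.
    by rewrite exprn_ile1 //; nra.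
  have := exprn_ge0 n s0; nra.
apply: (@squeeze_cvgr _ _ _ _ (fun=> 0) (fun n => (1 - s)^-1 * s ^+ n)).
- near=> n; rewrite mulr_ge0 ?exprn_ge0 //=.
  by rewrite -sE -exprM mul2n -addnn exprD mulrA ler_wpM2r ?exprn_ge0.
- exact: cvg_cst.
- rewrite -[X in _ --> X](mulr0 (1 - s)^-1); apply: cvgM; first exact: cvg_cst.
  by apply: cvg_expr; rewrite ger0_norm.
Unshelve. all: by end_near. Qed.

(** The outer exponent N = n 2^n gives N x^n = n (2 x)^n, which places the threshold at 1 / 2. *)
Definition step_approx n x : R := (1 - x ^+ n) ^+ (n * 2 ^ n).

Lemma step_approx_itv (n : nat) (x : R) : 0 <= x <= 1 -> 0 <= step_approx n x <= 1.
Proof.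
move=> /andP[x0 x1]; have xn1 : x ^+ n <= 1 by rewrite exprn_ile1.
have xn0 := exprn_ge0 n x0.
by rewrite exprn_ge0 ?subr_ge0 //= exprn_ile1 ?subr_ge0 // gerBl.
Qed.

(** Below 1 / 2, Bernoulli bounds the value from below by 1 - n (2 x)^n. From 1 / 2 on, (1 - x^n)^N
    (1 + x^n)^N <= 1 while (1 + x^n)^N >= 1 + n, so the value is at most 1 / (n + 1); this includes
    the threshold itself, whence the strict inequality in the limit. *)
Lemma step_approx_cvg x : 0 <= x <= 1 ->
  step_approx n x @[n --> \oo] --> ((x < 2^-1)%R%:R : R).
Proof.
move=> x01; have /andP[x0 x1] := x01.
have eN n : (n * 2 ^ n)%:R * x ^+ n = n%:R * (2 * x) ^+ n.
  by rewrite natrM natrX exprMn mulrA.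
case: ltP => [xl|xg] /=.
  apply: (@squeeze_cvgr _ _ _ _ (fun n => 1 - n%:R * (2 * x) ^+ n) (fun=> 1)).
  - near=> n; have /andP[_ ->] := step_approx_itv n x01; rewrite andbT.
    rewrite -eN -mulrN; apply: bernoulli_inequality.
    by rewrite lerN2 exprn_ile1.
  - rewrite -[X in _ --> X](subr0 1); apply: cvgB; first exact: cvg_cst.
    by apply: cvg_natM_geometric; lra.
  - exact: cvg_cst.
apply: (@squeeze_cvgr _ _ _ _ (fun=> 0) (@harmonic R)).
- near=> n; have /andP[-> _] := step_approx_itv n x01 => /=.
  rewrite /harmonic -[X in _ <= X]mul1r ler_pdivlMr //.
  set N := (n * 2 ^ n)%N; have xn0 := exprn_ge0 n x0.
  have xn1 : x ^+ n <= 1 by rewrite exprn_ile1.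
  have B : 1 + N%:R * x ^+ n <= (1 + x ^+ n) ^+ N by apply: bernoulli_inequality; lra.
  have nN : n.+1%:R <= (1 + x ^+ n) ^+ N.
    apply: le_trans B; rewrite -add1n natrD lerD2l eN.
    by rewrite ler_peMr // exprn_ege1 //; lra.
  apply: (@le_trans _ _ ((1 - x ^+ n) ^+ N * (1 + x ^+ n) ^+ N)).
    by rewrite ler_wpM2l // exprn_ge0 // subr_ge0.
  rewrite -exprMn -subr_sqr expr1n exprn_ile1 ?gerBl ?sqr_ge0 //.
  by rewrite subr_ge0 exprn_ile1.
- exact: cvg_cst.
- exact: cvg_harmonic.
Unshelve. all: by end_near. Qed.

End StepApproximation.

(** * Compactly supported measures are determined by their moments *)

Section MomentDeterminacy.
Variable R : realType.
Local Notation T := (R * R)%type.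
Implicit Types (f g h : T -> R[i]) (p : T) (m n : nat) (c : R[i]) (M a : R).

(** Polynomials in z and its conjugate, generated as functions: facts about them follow by
    induction, without a normal form as a sum of monomials. *)
Inductive polyf : (T -> R[i]) -> Prop :=
| polyf_cst c : polyf (fun=> c)
| polyf_toC : polyf (@toC R)
| polyf_conj : polyf (fun p => (toC p)^*)
| polyfD f g : polyf f -> polyf g -> polyf (fun p => f p + g p)
| polyfM f g : polyf f -> polyf g -> polyf (fun p => f p * g p).

Lemma polyfX f n : polyf f -> polyf (fun p => f p ^+ n).
Proof.
move=> pf; elim: n => [|n IH]; first exact: polyf_cst.
rewrite (_ : (fun p => _) = (fun p => f p * f p ^+ n)); first exact: polyfM.
by apply/funext => p; rewrite exprS.
Qed.

Lemma polyf_measurable f : polyf f ->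
  measurable_fun setT (fun p => complex.Re (f p)) /\
  measurable_fun setT (fun p => complex.Im (f p)).
Proof.
elim=> {f} [c|||f g _ [mf1 mf2] _ [mg1 mg2]|f g _ [mf1 mf2] _ [mg1 mg2]] /=.
- by split; exact: measurable_cst.
- by split; [exact: measurable_fst|exact: measurable_snd].
- split; [exact: measurable_fst|].
  by apply: (@measurable_funN _ _ _ _ snd); exact: measurable_snd.
- split.
    rewrite (_ : (fun p => _) = (fun p => complex.Re (f p) + complex.Re (g p))).
      exact: measurable_funD.
    by apply/funext => p; rewrite raddfD.
  rewrite (_ : (fun p => _) = (fun p => complex.Im (f p) + complex.Im (g p))).
    exact: measurable_funD.
  by apply/funext => p; rewrite raddfD.
- split.
    rewrite (_ : (fun p => _) = (fun p => complex.Re (f p) * complex.Re (g p) -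
                                          complex.Im (f p) * complex.Im (g p))).
      by apply: measurable_funB; exact: measurable_funM.
    by apply/funext => p; case: (f p) => ? ?; case: (g p).
  rewrite (_ : (fun p => _) = (fun p => complex.Re (f p) * complex.Im (g p) +
                                        complex.Im (f p) * complex.Re (g p))).
    by apply: measurable_funD; exact: measurable_funM.
  by apply/funext => p; case: (f p) => ? ?; case: (g p).
Qed.

Definition box M : set T := [set p | `|p.1| <= M /\ `|p.2| <= M].

Lemma measurable_box M : measurable (box M).
Proof.
have -> : box M = `[- M, M]%classic `*` `[- M, M]%classic.
  by apply/seteqP; split => -[x y] /=; rewrite /box /= !in_itv /= !ler_norml.
exact: measurableX.
Qed.

Lemma polyf_bounded M f : polyf f -> exists C, forall p, box M p ->
  `|complex.Re (f p)| <= C /\ `|complex.Im (f p)| <= C.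
Proof.
elim=> {f} [c|||f g _ [B Bf] _ [C Cg]|f g _ [B Bf] _ [C Cg]] /=.
- exists (`|complex.Re c| + `|complex.Im c|) => p _.
  by rewrite lerDl lerDr !normr_ge0.
- by exists M.
- by exists M => p; rewrite normrN.
- exists (B + C) => p pb; have [f1 f2] := Bf p pb; have [g1 g2] := Cg p pb.
  by rewrite !raddfD /=; split; apply: (le_trans (ler_normD _ _)); apply: lerD.
- exists (B * C + B * C) => p pb; have [f1 f2] := Bf p pb; have [g1 g2] := Cg p pb.
  case: (f p) f1 f2 => a b /= a1 b1; case: (g p) g1 g2 => x y /= x1 y1.
  split; first apply: (le_trans (ler_normB _ _)); last apply: (le_trans (ler_normD _ _)).
    by apply: lerD; rewrite normrM; apply: ler_pM.
  by apply: lerD; rewrite normrM; apply: ler_pM.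
Qed.

Definition cintegral (nu : probability T R) f : R[i] :=
  (\int[nu]_p complex.Re (f p)) +i* (\int[nu]_p complex.Im (f p)).

Section Supported.
Variables (nu : probability T R) (M : R).
Hypothesis nu_box : nu (~` box M) = 0%E.

Lemma polyf_integrable f : polyf f ->
  nu.-integrable setT (EFin \o (fun p => complex.Re (f p))) /\
  nu.-integrable setT (EFin \o (fun p => complex.Im (f p))).
Proof.
move=> pf; have [m1 m2] := polyf_measurable pf.
have [C Cf] := polyf_bounded M pf.
have mb : measurable (~` box M) by apply: measurableC; exact: measurable_box.
by split; apply: (@bounded_off_null_integrable _ _ _ nu _ _ C mb nu_box) => // p
  /contrapT /Cf[].
Qed.

Lemma cintegralD f g : polyf f -> polyf g ->
  cintegral nu (fun p => f p + g p) = cintegral nu f + cintegral nu g.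
Proof.
move=> /polyf_integrable[f1 f2] /polyf_integrable[g1 g2].
rewrite /cintegral; simpc; congr (_ +i* _).
  by rewrite -RintegralD //; apply: eq_Rintegral => p _; rewrite raddfD.
by rewrite -RintegralD //; apply: eq_Rintegral => p _; rewrite raddfD.
Qed.

Lemma cintegralZ c f : polyf f ->
  cintegral nu (fun p => c * f p) = c * cintegral nu f.
Proof.
move=> /polyf_integrable[f1 f2].
have Zint (x : R) (u : T -> R) : nu.-integrable setT (EFin \o u) ->
    nu.-integrable setT (EFin \o (fun p => x * u p)).
  by move=> iu; apply: (eq_integrable _ (fun p => x%:E * (u p)%:E)%E) => //;
    exact: integrableZl.
rewrite /cintegral; case: c => a b; simpc; congr (_ +i* _).
  rewrite -!RintegralZl // -RintegralB //; [|exact: Zint..].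
  by apply: eq_Rintegral => p _; case: (f p).
rewrite -!RintegralZl // -RintegralD //; [|exact: Zint..].
by apply: eq_Rintegral => p _; case: (f p).
Qed.

End Supported.

Section Determinacy.
Variables (nu nu' : probability T R) (M : R).
Hypothesis nu_box : nu (~` box M) = 0%E.
Hypothesis nu'_box : nu' (~` box M) = 0%E.
Hypothesis moments : forall m n, cmoment nu m n = cmoment nu' m n.

Lemma cintegral_polyf f : polyf f -> cintegral nu f = cintegral nu' f.
Proof.
pose mono m n p := toC p ^+ m * (toC p)^* ^+ n.
have pmono m n : polyf (mono m n).
  by apply: polyfM; apply: polyfX; [exact: polyf_toC|exact: polyf_conj].
suff S : forall f, polyf f -> forall g, polyf g ->
    (forall m n, cintegral nu (fun p => g p * mono m n p) =
                 cintegral nu' (fun p => g p * mono m n p)) ->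
    (forall m n, cintegral nu (fun p => f p * g p * mono m n p) =
                 cintegral nu' (fun p => f p * g p * mono m n p)).
  move=> pf; have := S f pf (fun=> 1) (polyf_cst 1) _ 0%N 0%N.
  have -> : (fun p => f p * 1 * mono 0%N 0%N p) = f.
    by apply/funext => p; rewrite /mono !expr0 !mulr1.
  apply=> m n; have -> : (fun p => 1 * mono m n p) = mono m n.
    by apply/funext => p; rewrite mul1r.
  exact: moments.
move=> {}f; elim=> {f} [c|||f g pf IHf pg IHg|f g pf IHf pg IHg] h ph H m n.
- under eq_fun do rewrite -mulrA.
  by rewrite !(@cintegralZ _ M) ?H //; apply: polyfM.
- have E : (fun p => toC p * h p * mono m n p) = (fun p => h p * mono m.+1 n p).
    by apply/funext => p; rewrite /mono exprS; ring.
  by rewrite E H.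
- have E : (fun p => (toC p)^* * h p * mono m n p) = (fun p => h p * mono m n.+1 p).
    by apply/funext => p; rewrite /mono exprS; ring.
  by rewrite E H.
- have E : (fun p => (f p + g p) * h p * mono m n p) =
      (fun p => f p * h p * mono m n p + g p * h p * mono m n p).
    by apply/funext => p; ring.
  rewrite E !(@cintegralD _ M) ?IHf ?IHg //; by apply: polyfM => //; exact: polyfM.
- have E : (fun p => f p * g p * h p * mono m n p) =
      (fun p => f p * (g p * h p) * mono m n p).
    by apply/funext => p; ring.
  rewrite E; apply: IHf; first exact: polyfM.
  by move=> m' n'; apply: IHg.
Qed.

(** Uniform bounds and pointwise limits on the box are what dominated convergence uses for a measure
    carried by the box; the bounds in [0, 1] also survive products, hence intersections of sets. *)
Definition approximable (A : set T) := measurable A /\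
  exists h : nat -> T -> R,
    [/\ forall n, polyf (fun p => (h n p)%:C),
        forall n p, box M p -> 0 <= h n p <= 1 &
        forall p, box M p -> h n p @[n --> \oo] --> (\1_A p : R)].

Lemma approximable_setT : approximable setT.
Proof.
split => //; exists (fun _ _ => 1); split=> [n|n p _|p _].
- exact: polyf_cst.
- by rewrite lexx ler01.
- by rewrite indicT; exact: cvg_cst.
Qed.

Lemma approximableI A B : approximable A -> approximable B ->
  approximable (A `&` B).
Proof.
move=> [mA [h [ph h01 hA]]] [mB [k [pk k01 kB]]]; split; first exact: measurableI.
exists (fun n p => h n p * k n p); split=> [n|n p pb|p pb].
- have -> : (fun p => (h n p * k n p)%:C) = (fun p => (h n p)%:C * (k n p)%:C).
    by apply/funext => p; rewrite rmorphM.
  exact: polyfM.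
- have /andP[h0 h1] := h01 n p pb; have /andP[k0 k1] := k01 n p pb.
  by rewrite mulr_ge0 //= mulr_ile1.
- by rewrite indicI; apply: cvgM; [exact: hA|exact: kB].
Qed.

Hypothesis M_gt0 : 0 < M.

Lemma approximable_halfspace (u : T -> R) a : measurable_fun setT u ->
  polyf (fun p => (u p)%:C) -> (forall p, box M p -> `|u p| <= M) ->
  approximable [set p | u p < a].
Proof.
move=> mu pu ub; pose L := M + `|a|.
have L0 : 0 < L by rewrite ltr_pwDl.
split.
  rewrite (_ : [set p | u p < a] = u @^-1` `]-oo, a[%classic); last first.
    by apply/seteqP; split => p /=; rewrite in_itv.
  by rewrite -[X in measurable X]setTI; exact: mu.
(* On the box |u - a| <= L = M + |a|, so v maps into [0, 1], and v < 1 / 2 exactly when u < a. *)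
pose v p := 2^-1 + (u p - a) / (2 * L).
have v01 p : box M p -> 0 <= v p <= 1.
  move=> /ub pb; have ual : `|u p - a| <= L.
    by apply: (le_trans (ler_normB _ _)); rewrite lerD2r.
  have : `|(u p - a) / (2 * L)| <= 2^-1.
    rewrite normrM normfV (gtr0_norm (_ : 0 < 2 * L)) ?mulr_gt0 //.
    by rewrite ler_pdivrMr ?mulr_gt0 // mulKf ?pnatr_eq0.
  rewrite ler_norml /v => /andP[]; lra.
exists (fun n p => step_approx n (v p)); split=> [n|n p pb|p pb].
- under eq_fun => p.
    rewrite rmorphXn rmorphB rmorph1 rmorphXn rmorphD rmorphM rmorphB /=.
    over.
  apply/polyfX/polyfD; first exact: polyf_cst.
  have -> : (fun p => - ((2^-1)%:C + ((u p)%:C - a%:C) * (2 * L)^-1%:C) ^+ n) =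
     (fun p => (-1) * ((2^-1)%:C + ((u p)%:C + - a%:C) * (2 * L)^-1%:C) ^+ n).
    by apply/funext => p; rewrite mulN1r.
  apply: polyfM; first exact: polyf_cst.
  apply/polyfX/polyfD; first exact: polyf_cst.
  apply: polyfM; last exact: polyf_cst.
  by apply: polyfD => //; exact: polyf_cst.
- exact/step_approx_itv/v01.
- have := step_approx_cvg (v01 p pb).
  rewrite indicE mem_setE /= (_ : (v p < 2^-1) = (u p < a)) //.
  by rewrite /v gtrDl pmulr_llt0 ?subr_lt0 // invr_gt0 mulr_gt0.
Qed.

Lemma approximable_eq A : approximable A -> nu A = nu' A.
Proof.
move=> [mA [h [ph h01 hA]]].
have cvgmu (mu : probability T R) : mu (~` box M) = 0%E ->
    (\int[mu]_p (h n p)%:E)%E @[n --> \oo] --> mu A.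
  move=> mu0; have mh n := (polyf_measurable (ph n)).1.
  have negl : mu.-negligible (~` box M).
    by exists (~` box M); split => //; apply: measurableC; exact: measurable_box.
  rewrite -[X in _ --> mu X]setIT -integral_indic //.
  have [|||||_ _] := @dominated_convergence _ _ _ mu setT measurableT
      (fun n p => (h n p)%:E) (fun p => (\1_A p)%:E) (cst 1%E) => //.
  - by move=> n; apply/measurable_EFinP; exact: mh.
  - exact/measurable_EFinP/measurable_indic.
  - apply: (negligibleS _ negl) => p /= np pb; apply: np => _.
    by apply: cvg_EFin; [exact: nearW|exact: hA].
  - exact: finite_measure_integrable_cst.
  - apply: (negligibleS _ negl) => p /= np pb; apply: np => n _.
    have /andP[h0 h1] := h01 n p pb.
    by rewrite lee_fin ger0_norm.
have E n : (\int[nu]_p (h n p)%:E = \int[nu']_p (h n p)%:E)%E.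
  have := cintegral_polyf (ph n) => -[].
  rewrite /Rintegral /= => H _.
  have [i1 _] := polyf_integrable nu_box (ph n).
  have [i2 _] := polyf_integrable nu'_box (ph n).
  rewrite -[LHS]fineK ?integrable_fin_num // -[RHS]fineK ?integrable_fin_num //.
  by rewrite H.
have := cvgmu _ nu_box; under eq_fun do rewrite E.
move=> l1; have l2 := cvgmu _ nu'_box.
exact: (cvg_unique (@ereal_hausdorff R) l1 l2).
Qed.

Lemma moments_determine A : measurable A -> nu A = nu' A.
Proof.
move=> mA; pose GT := g_sigma_algebraType approximable.
apply: (@g_sigma_algebra_measure_unique _ _ _ approximable _ (fun=> setT)).
- by move=> B [].
- by move=> _; exact: approximable_setT.
- by rewrite bigcup_const //; exists 0%N.
- exact: approximableI.
- exact: approximable_eq.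
- by move=> _ /=; rewrite probability_setT ltry.
(* What remains is that approximable sets generate the Borel sets. Open half-planes are
   approximable, so both coordinates, and with them the identity map, are measurable for the
   generated sigma-algebra. *)
have mu (u : T -> R) : measurable_fun setT u ->
    polyf (fun p => (u p)%:C) -> (forall p, box M p -> `|u p| <= M) ->
    @measurable_fun _ _ GT R setT u.
  move=> mu pu ub; apply: (measurability _ (RGenInftyO.measurableE R)).
  move=> _ [_ [a ->] <-]; rewrite setTI.
  apply: sub_sigma_algebra.
  rewrite (_ : _ @^-1` _ = [set p | u p < a]).
    exact: approximable_halfspace.
  by apply/seteqP; split => p /=; rewrite in_itv.
have pRe : polyf (fun p => p.1%:C).
  have -> : (fun p : T => p.1%:C) = (fun p => (2^-1)%:C * (toC p + (toC p)^*)).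
    apply/funext => -[x y]; rewrite /toC /=; simpc.
    by apply/eqP; rewrite eq_complex /=; apply/andP; split; apply/eqP; lra.
  apply: polyfM; first exact: polyf_cst.
  by apply: polyfD; [exact: polyf_toC|exact: polyf_conj].
have pIm : polyf (fun p => p.2%:C).
  have -> : (fun p : T => p.2%:C) =
      (fun p => (0 +i* (- 2^-1)) * (toC p + (-1) * (toC p)^*)).
    apply/funext => -[x y]; rewrite /toC /=; simpc.
    by apply/eqP; rewrite eq_complex /=; apply/andP; split; apply/eqP; lra.
  apply: polyfM; first exact: polyf_cst.
  apply: polyfD; first exact: polyf_toC.
  by apply: polyfM; [exact: polyf_cst|exact: polyf_conj].
have mfst := mu fst measurable_fst pRe (fun p (pb : box M p) => pb.1).
have msnd := mu snd measurable_snd pIm (fun p (pb : box M p) => pb.2).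
have mid : @measurable_fun _ _ GT (R * R)%type setT id.
  rewrite (_ : id = (fun p => (p.1, p.2))); last by apply/funext => -[].
  exact: (measurable_fun_pair mfst msnd).
by rewrite -[A]preimage_id -[X in <<s _ >> X]setTI; exact: mid.
Qed.

End Determinacy.
End MomentDeterminacy.

(** * The images of the two fundamental characters *)

Section Images.
Variable R : realType.
Implicit Types (z w : R[i]) (p : R * R).

Lemma norm_toC p : `|toC p| = (Num.sqrt (p.1 ^+ 2 + p.2 ^+ 2))%:C.
Proof. by rewrite normc_def. Qed.

Lemma norm_toC_le2 p : (`|toC p| <= 2) = (p.1 ^+ 2 + p.2 ^+ 2 <= 2 ^+ 2).
Proof.
rewrite norm_toC (_ : 2 = 2%:C); last by rewrite rmorph_nat.
rewrite lecR -[X in _ <= X]ger0_norm // -sqrtr_sqr ler_sqrt //.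
Qed.

Lemma norm_toC_eq1 p : `|toC p| = 1 <-> p.1 ^+ 2 + p.2 ^+ 2 = 1.
Proof.
rewrite norm_toC; split => [/(congr1 (@complex.Re R)) /= s1|->]; last first.
  by rewrite sqrtr1.
by rewrite -[LHS]sqr_sqrtr ?s1 ?expr1n // addr_ge0 ?sqr_ge0.
Qed.

Lemma toC_polar p : toC (polar p) = p.1%:C * cis p.2.
Proof. by rewrite /toC /polar /cis /=; simpc. Qed.

Lemma norm_toC_polar p : `|toC (polar p)| = `|p.1|%:C.
Proof.
by rewrite toC_polar normrM cis_norm mulr1 normc_def /= expr0n addr0 sqrtr_sqr.
Qed.

Lemma chi_image_rho1 : chi_image (R := R) rho1 = [set z : R[i] | `|z| <= 2].
Proof.
apply/seteqP; split => z /=.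
  move=> [w1 [w2 [u1 u2 ->]]]; rewrite chi_rho1.
  by apply: le_trans (ler_normD _ _) _; rewrite u1 u2.
have [u [r [uu r0 ->]]] : exists u (r : R), [/\ unit_circle u, 0 <= r & z = u * r%:C].
  have [->|z0] := eqVneq z 0.
    by exists 1, 0; split => //; [exact: normr1|rewrite mulr0].
  exists (z / `|z|), (complex.Re `|z|); have nz : `|z| = (complex.Re `|z|)%:C.
    by rewrite normc_def.
  split.
  - by rewrite /unit_circle /= normrM normfV normr_id mulfV ?normr_eq0.
  - by rewrite normc_def /= sqrtr_ge0.
  - by rewrite -nz divfK ?normr_eq0.
rewrite normrM uu mul1r normc_def /= expr0n addr0 sqrtr_sqr ger0_norm //.
have -> : 2 = 2%:C :> R[i] by rewrite rmorph_nat.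
rewrite lecR => r2.
(* With cos a = r / 2 and sin a = s, the radius r is e^(i a) + e^(-i a); rotating both summands by u
   gives z. *)
pose s := Num.sqrt (1 - (r / 2) ^+ 2).
have s2 : s ^+ 2 = 1 - (r / 2) ^+ 2.
  rewrite sqr_sqrtr // subr_ge0 exprn_ile1 //; first by rewrite divr_ge0.
  by rewrite ler_pdivrMr ?mul1r.
have unit_pm (e : R) : e ^+ 2 = s ^+ 2 -> unit_circle (u * ((r / 2) +i* e)).
  move=> e2; rewrite /unit_circle /= normrM uu mul1r normc_def /= e2 s2.
  by rewrite subrKC sqrtr1.
exists (u * ((r / 2) +i* s)), (u * ((r / 2) +i* (- s))); split.
- exact: unit_pm.
- by apply: unit_pm; rewrite sqrrN.
- rewrite chi_rho1 -mulrDr; congr (_ * _); simpc; congr (_ +i* _); lra.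
Qed.

Lemma chi_image_rho2 : chi_image (R := R) rho2 = [set z : R[i] | `|z| = 1].
Proof.
apply/seteqP; split => z /=.
  by move=> [w1 [w2 [u1 u2 ->]]]; rewrite chi_rho2 normrM u1 u2 mulr1.
move=> z1; exists z, 1; split => //; first exact: normr1.
by rewrite chi_rho2 mulr1.
Qed.

End Images.

(** * Image measures of densities *)

Section PushedDensity.
Context d d' (T : measurableType d) (T' : measurableType d') (R : realType).
Variables (mu : {sigma_finite_measure set T -> \bar R}) (w : T -> R) (phi : T -> T').
Hypothesis w_ge0 : forall x, 0 <= w x.
Hypothesis mw : measurable_fun setT w.
Hypothesis w1 : (\int[mu]_x (w x)%:E)%E = 1%E.
Hypothesis mphi : measurable_fun setT phi.

Let X : T -> T' := phi.
HB.instance Definition _ := isMeasurableFun.Build _ _ _ _ X mphi.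

Lemma pushed_density_probability : exists nu : probability T' R,
  (forall A, measurable A -> nu A = (\int[mu]_(x in phi @^-1` A) (w x)%:E)%E) /\
  forall (N : set T') (u : T' -> R) (C : R),
    measurable N -> nu N = 0%E -> measurable_fun setT u ->
    (forall y, ~ N y -> `|u y| <= C) ->
    \int[nu]_y u y = \int[mu]_x (u (phi x) * w x).
Proof.
have [P PE] := density_probability w_ge0 mw w1.
pose nu : probability T' R := distribution P X.
have mpre A : measurable A -> measurable (phi @^-1` A).
  by move=> mA; rewrite -[X in measurable X]setTI; exact: mphi.
have nuE A : measurable A -> nu A = (\int[mu]_(x in phi @^-1` A) (w x)%:E)%E.
  by move=> mA; rewrite -PE //; exact: mpre.
exists nu; split => // N u C mN nuN mu' ub; rewrite /Rintegral.
have iP : P.-integrable setT (EFin \o (u \o phi)).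
  apply: (@bounded_off_null_integrable _ _ _ P (phi @^-1` N) _ C).
  - exact: mpre.
  - by rewrite PE ?nuE //; [rewrite -nuE|exact: mpre].
  - exact: measurableT_comp.
  - by move=> x /ub.
congr fine; rewrite -(integral_density w_ge0 mw PE iP).
by rewrite integral_distribution //; exact/measurable_EFinP.
Qed.

End PushedDensity.

(** * Orthogonality over a full turn *)

Section AngularIntegrals.
Variable R : realType.
Local Notation lam := (@lebesgue_measure R).
Implicit Types (m n : nat) (t : R).

Definition turn : set R := `[0, 2 * pi[%classic.

Lemma measurable_turn : measurable turn.
Proof. exact: measurable_itv. Qed.

Lemma sub_turn : turn `<=` `[0, 2 * pi]%classic.
Proof. by move=> x; rewrite /turn /= !in_itv /= => /andP[-> /ltW]. Qed.

Lemma cis_2pi : cis (2 * pi) = 1 :> R[i].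
Proof. by rewrite -(cisX pi 2) cis_pi sqrrN expr1n. Qed.

(** The two components supply the endpoint values for the cosine and the sine integrals. *)
Lemma cis_diff_2pi m n : cis ((m%:R - n%:R) * (2 * pi)) = 1 :> R[i].
Proof.
by rewrite mulrBl cisD -cisV -(cisX _ m) -(cisX _ n) cis_2pi !expr1n invr1 mulr1.
Qed.

Lemma mul_indic_turn_integrable (f : R -> R) : continuous f ->
  lam.-integrable setT (EFin \o (fun t => f t * \1_turn t)).
Proof.
move=> cf; have -> : EFin \o (fun t => f t * \1_turn t) = (EFin \o f) \_ turn.
  by rewrite restrict_EFin patch_indic.
apply: (@integrable_mkcond _ _ _ lam turn (EFin \o f) measurable_turn).1.
apply: (@integrableS _ _ _ lam `[0, 2 * pi]%classic turn (EFin \o f)) => //.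
- exact: measurable_turn.
- exact: sub_turn.
- exact: continuous_itv_integrable.
Qed.

Lemma Rintegral_turn (f : R -> R) : continuous f ->
  \int[lam]_t (f t * \1_turn t) = \int[lam]_(t in `[0, 2 * pi]) f t.
Proof.
move=> cf; have -> : (fun t => f t * \1_turn t) = f \_ turn by rewrite patch_indic.
rewrite -Rintegral_mkcond /turn Rintegral_itv_bndo_bndc //.
apply: (@integrableS _ _ _ lam `[0, 2 * pi]%classic turn (EFin \o f)) => //.
- exact: measurable_turn.
- exact: sub_turn.
- exact: continuous_itv_integrable.
Qed.

Lemma Rintegral_cos_turn m n :
  \int[lam]_t (cos ((m%:R - n%:R) * t) * \1_turn t) =
  if m == n then 2 * pi else 0.
Proof.
have pi20 : 0 < 2 * pi :> R by rewrite mulr_gt0 // pi_gt0.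
rewrite Rintegral_turn; last exact: continuous_cosM.
case: eqVneq => [->|mn].
  under eq_Rintegral do rewrite subrr mul0r cos0.
  have E : lam `[0, 2 * pi]%classic = (2 * pi)%:E.
    by rewrite lebesgue_measure_itv /= lte_fin pi20 -EFinD subr0.
  by rewrite Rintegral_cst // mul1r; move: E => /= ->.
rewrite Rintegral_cosM //; last by rewrite subr_eq0 eqr_nat.
have [_ ->] := cis_diff_2pi m n.
by rewrite mulr0 sin0 subrr mulr0.
Qed.

Lemma Rintegral_sin_turn m n :
  \int[lam]_t (sin ((m%:R - n%:R) * t) * \1_turn t) = 0.
Proof.
have pi20 : 0 < 2 * pi :> R by rewrite mulr_gt0 // pi_gt0.
rewrite Rintegral_turn; last exact: continuous_sinM.
have [->|mn] := eqVneq m n.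
  under eq_Rintegral do rewrite subrr mul0r sin0.
  by rewrite Rintegral_cst // mul0r.
set c : R := m%:R - n%:R; have c0 : c != 0 by rewrite subr_eq0 eqr_nat.
pose F t : R := - c^-1 * cos (c * t).
suff -> : \int[lam]_(t in `[0, 2 * pi]) sin (c * t) = F (2 * pi) - F 0.
  have [E _] := cis_diff_2pi m n.
  by rewrite /F E mulr0 cos0 subrr.
apply: Rintegral_FTC => // [|x]; first exact: continuous_sinM.
have := is_deriveZ (- c^-1) (is_derive_cosM c x).
by rewrite /GRing.scale /= mulrA mulrNN mulVf // mul1r.
Qed.

End AngularIntegrals.

(** * Monomials and the disc density in polar coordinates *)

Section Measures.
Variable R : realType.
Local Notation lam := (@lebesgue_measure R).
Implicit Types (m n : nat) (p : R * R) (t : R).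

Definition monomial m n p : R[i] := toC p ^+ m * (toC p)^* ^+ n.

Lemma polyf_monomial m n : polyf (monomial m n).
Proof. by apply: polyfM; apply: polyfX; [exact: polyf_toC|exact: polyf_conj]. Qed.

Lemma monomial_polar m n p :
  monomial m n (polar p) = (p.1 ^+ (m + n))%:C * cis ((m%:R - n%:R) * p.2).
Proof.
have conjE : Num.conj (p.1%:C * cis p.2) = p.1%:C * cis (- p.2).
  rewrite rmorphM -cis_conj; congr (_ * _).
  by apply/eqP; rewrite eq_complex /= oppr0 !eqxx.
rewrite /monomial toC_polar conjE !exprMn !cisX.
rewrite mulrACA -exprD -rmorphXn -cisD; congr (_ * cis _).
by rewrite mulrN -mulrBl.
Qed.

Lemma measurable_polar : measurable_fun setT (@polar R).
Proof.
have m2 (f : R -> R) : continuous f -> measurable_fun setT (fun p : R * R => p.1 * f p.2).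
  move=> cf; apply: measurable_funM; first exact: measurable_fst.
  apply: (measurableT_comp (continuous_measurable_fun cf)).
  exact: measurable_snd.
by apply: measurable_fun_pair; apply: m2; [exact: continuous_cos|exact: continuous_sin].
Qed.

Lemma measurable_normsq (B : set R) : measurable B ->
  measurable [set p : R * R | B (p.1 ^+ 2 + p.2 ^+ 2)].
Proof.
move=> mB; rewrite -[X in measurable X]setTI.
have mf : measurable_fun setT (fun p : R * R => p.1 ^+ 2 + p.2 ^+ 2).
  by apply: measurable_funD; apply: measurable_funX;
    [exact: measurable_fst|exact: measurable_snd].
exact: mf.
Qed.

Lemma measurable_disc : measurable (@toC R @^-1` [set z | `|z| <= 2]).
Proof.
rewrite (_ : _ @^-1` _ = [set p | `]-oo, 2 ^+ 2]%classic (p.1 ^+ 2 + p.2 ^+ 2)]).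
  exact: measurable_normsq.
by apply/seteqP; split => p; rewrite /= norm_toC_le2 in_itv.
Qed.

Lemma measurable_circle : measurable (@toC R @^-1` [set z | `|z| = 1]).
Proof.
rewrite (_ : _ @^-1` _ = [set p | [set 1] (p.1 ^+ 2 + p.2 ^+ 2)]).
  exact: measurable_normsq.
by apply/seteqP; split => p /norm_toC_eq1.
Qed.

Lemma disc_box p : `|toC p| <= 2 -> box 2 p.
Proof.
rewrite norm_toC_le2 => p2; split; rewrite -(ler_pXn2r (_ : 0 < 2)%N) ?nnegrE //;
  rewrite real_normK ?num_real //; apply: le_trans p2.
  by rewrite lerDl sqr_ge0.
by rewrite lerDr sqr_ge0.
Qed.

(** A density on the parameter plane: [p] stands for (r, theta), not for a point of the disc. *)
Definition disc_density p : R :=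
  (2 * pi ^+ 2)^-1 * Num.sqrt (4 - p.1 ^+ 2) * \1_(polar_domain 2) p.

Definition radial (r : R) : R :=
  (2 * pi ^+ 2)^-1 * (Num.sqrt (4 - r ^+ 2) * \1_(`[0, 2]%classic : set R) r).

Lemma disc_densityE p : disc_density p = radial p.1 * \1_(@turn R) p.2.
Proof.
rewrite /disc_density /radial -!mulrA; congr (_ * (_ * _)).
by rewrite !indicE -natrM mulnb -in_setX.
Qed.

Lemma integral_disc (f : R -> R) n : continuous f ->
  (\int[@lebesgue2 R]_p (p.1 ^+ n * f p.2 * disc_density p)%:E =
  ((2 * pi ^+ 2)^-1 * \int[lam]_(r in `[0, 2]) (r ^+ n * Num.sqrt (4 - r ^+ 2)) *
   \int[lam]_t (f t * \1_(@turn R) t))%:E)%E.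
Proof.
move=> cf; pose g (r : R) := r ^+ n * Num.sqrt (4 - r ^+ 2).
have cg : continuous g.
  move=> r; apply: cvgM; first exact: exprn_continuous.
  apply: (@continuous_comp _ _ _ (fun r : R => 4 - r ^+ 2) Num.sqrt).
    by apply: cvgB; [exact: cvg_cst|exact: exprn_continuous].
  exact: sqrt_continuous.
have ig : lam.-integrable setT (EFin \o (g \_ `[0, 2]%classic)).
  rewrite -restrict_EFin.
  apply: (@integrable_mkcond _ _ _ lam `[0, 2]%classic (EFin \o g) (measurable_itv _)).1.
  exact: continuous_itv_integrable.
pose c : R := (2 * pi ^+ 2)^-1.
have icg : lam.-integrable setT (EFin \o (fun r => c * (g \_ `[0, 2]%classic) r)).
  exact: (integrableZl measurableT c ig).
have cE : c * \int[lam]_(r in `[0, 2]) g r =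
    \int[lam]_r (c * (g \_ `[0, 2]%classic) r).
  by rewrite Rintegral_mkcond -RintegralZl.
rewrite -/c cE.
have E := integral_prodM icg (mul_indic_turn_integrable cf).
apply: (etrans _ E); apply: eq_integral => p _; congr EFin.
rewrite disc_densityE /radial patch_indic /g /c /=; ring.
Qed.

End Measures.

(** * Construction and identification of the spectral measures *)

Section SpectralMeasures.
Variable R : realType.
Local Notation lam := (@lebesgue_measure R).
Implicit Types (m n : nat) (p : R * R) (t : R).

Lemma null_box_disc (nu : probability (R * R)%type R) (K : set R[i]) :
  measurable (@toC R @^-1` K) -> K `<=` [set z | `|z| <= 2] ->
  nu (@toC R @^-1` (~` K)) = 0%E -> nu (~` box 2) = 0%E.
Proof.
move=> mK K2 nuK; apply/eqP; rewrite eq_le measure_ge0 andbT -nuK.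
apply: le_measure; rewrite ?inE.
- by apply: measurableC; exact: measurable_box.
- exact: measurableC mK.
- by move=> p pb Kp; apply: pb; apply/disc_box/K2.
Qed.

Lemma spectral_measure_of_moments (sh : seq (int * int)) (K : set R[i])
    (nu : probability (R * R)%type R) : uniq sh ->
  measurable (@toC R @^-1` K) -> K `<=` [set z | `|z| <= 2] ->
  nu (@toC R @^-1` (~` K)) = 0%E ->
  (forall m n, cmoment nu m n = (nb_trips (shift_mult sh) (shift_succ sh)
     (shift_pred sh) weight0 m n weight0)%:R) ->
  is_spectral_measure (shift_mult sh) weight0 K nu.
Proof.
move=> ush mK K2 nuK mom.
have card m n := card_path_pairs (fun x => shift_succ_uniq x ush)
  (fun x => shift_pred_uniq x ush) (mem_shift_succ sh)
  (fun x y => mem_shift_pred sh x y) weight0 m n.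
split.
  split=> // m n; eexists; first exact: card.
  exact: mom.
move=> nu' [nu'K mom'] A mA.
apply: (@moments_determine _ nu' nu 2) => //.
- exact: null_box_disc mK K2 nu'K.
- exact: null_box_disc mK K2 nuK.
(* Both moments are cardinals of the same finite set of path pairs. *)
- move=> m n; have [k cardk ->] := mom' m n; rewrite mom; congr _%:R.
  by apply/card_eq_II; apply: card_eq_trans (card m n); rewrite card_eq_sym.
Qed.

Lemma cmoment_pushed d (T : measurableType d)
    (mu : {sigma_finite_measure set T -> \bar R}) (w : T -> R) (phi : T -> R * R)
    (nu : probability (R * R)%type R) m n :
  (forall (N : set (R * R)) (u : R * R -> R) (C : R),
    measurable N -> nu N = 0%E -> measurable_fun setT u ->
    (forall y, ~ N y -> `|u y| <= C) ->
    \int[nu]_y u y = \int[mu]_x (u (phi x) * w x)) ->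
  nu (~` box 2) = 0%E ->
  cmoment nu m n =
    (\int[mu]_x (complex.Re (monomial m n (phi x)) * w x)) +i*
    (\int[mu]_x (complex.Im (monomial m n (phi x)) * w x)).
Proof.
move=> nuE nub.
have [mR mI] := polyf_measurable (polyf_monomial R m n).
have [C Cb] := polyf_bounded 2 (polyf_monomial R m n).
have mb : measurable (~` box (2 : R)) by apply: measurableC; exact: measurable_box.
by congr (_ +i* _); apply: (nuE _ _ C mb nub) => // p /contrapT /Cb[].
Qed.

Lemma disc_density_ge0 p : 0 <= disc_density p.
Proof.
rewrite /disc_density !mulr_ge0 ?sqrtr_ge0 // invr_ge0 mulr_ge0 //.
exact: sqr_ge0.
Qed.

Lemma measurable_disc_density : measurable_fun setT (@disc_density R).
Proof.
apply: measurable_funM; last first.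
  apply: measurable_indic; apply: measurableX; exact: measurable_itv.
apply: (@measurableT_comp _ _ _ _ _ _
  (fun r : R => (2 * pi ^+ 2)^-1 * Num.sqrt (4 - r ^+ 2))); last exact: measurable_fst.
apply: continuous_measurable_fun => r; apply: cvgM; first exact: cvg_cst.
apply: (@continuous_comp _ _ _ (fun r : R => 4 - r ^+ 2) Num.sqrt).
  by apply: cvgB; [exact: cvg_cst|exact: exprn_continuous].
exact: sqrt_continuous.
Qed.

(** The radial integral contributes pi and the angular one 2 pi, which together cancel the constant
    of the density. *)
Lemma disc_density_moment m n : (2 * pi ^+ 2)^-1 *
    \int[lam]_(r in `[0, 2]) (r ^+ (m + n) * Num.sqrt (4 - r ^+ 2)) *
    (if m == n then 2 * pi else 0) =
  if m == n then cheb_moment R (m + n) 0 else 0.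
Proof.
have pi0 : pi != 0 :> R by rewrite gt_eqF // pi_gt0.
case: eqVneq => [->|_]; last by rewrite mulr0.
rewrite addnn Rintegral_semicircle_moment.
move: (pi : R) pi0 (cheb_moment R _ _) => q q0 c.
by field.
Qed.

Lemma disc_measure : exists nu : probability (R * R)%type R,
  [/\ forall A, measurable A -> nu A = integral_drdtheta 2 A (fun x =>
         (2 * pi ^+ 2)^-1 * Num.sqrt (4 - complex.Re `|x| ^+ 2)),
      nu (@toC R @^-1` (~` [set z | `|z| <= 2])) = 0%E &
      forall m n, cmoment nu m n =
        ((if m == n then cheb_moment R (m + n) 0 else 0) : R)%:C].
Proof.
have w1 : (\int[@lebesgue2 R]_p (disc_density p)%:E = 1)%E.
  (* The total mass is the moment with m = n = 0, so the constant 1 is written as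
     [cos ((0 - 0) * t)]. *)
  have := integral_disc 0 (@continuous_cosM R (0%:R - 0%:R)).
  rewrite Rintegral_cos_turn (disc_density_moment 0 0) eqxx cheb_moment0 //= => <-.
  apply: eq_integral => p _; rewrite expr0 mul1r.
  by rewrite (_ : (0 - 0) * p.2 = 0) ?cos0 ?mul1r // subrr mul0r.
have [nu [nuE nuI]] := @pushed_density_probability _ _ _ (R * R)%type R
  (@lebesgue2 R) (@disc_density R) (@polar R) disc_density_ge0
  measurable_disc_density w1 (@measurable_polar R).
have mKC : measurable (@toC R @^-1` (~` [set z | `|z| <= 2])).
  exact: measurableC (@measurable_disc R).
have nuK : nu (@toC R @^-1` (~` [set z | `|z| <= 2])) = 0%E.
  (* The density vanishes outside the strip 0 <= r <= 2, and [polar] maps the strip into the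
     disc. *)
  rewrite nuE //; apply: integral0_eq => p /= Kp; congr EFin.
  rewrite /disc_density indicE memNset ?mulr0 // => -[/= p1 _]; apply: Kp.
  move: p1; rewrite in_itv /= => /andP[r0 r2].
  rewrite norm_toC_polar (_ : 2 = 2%:C :> R[i]) ?lecR ?ger0_norm //.
  by rewrite rmorph_nat.
have nub : nu (~` box 2) = 0%E.
  exact: null_box_disc (@measurable_disc R) _ nuK.
exists nu; split => // [A mA|m n].
  rewrite nuE // /integral_drdtheta integral_mkcondl epatch_indic.
  apply: eq_integral => p _ /=; rewrite -EFinM; congr EFin.
  have : complex.Re `|toC (polar p)| ^+ 2 = p.1 ^+ 2.
    by rewrite norm_toC_polar /= real_normK // num_real.
  by rewrite /= => ->.
rewrite (cmoment_pushed _ _ nuI nub).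
have reE : \int[@lebesgue2 R]_p
      (complex.Re (monomial m n (polar p)) * disc_density p) =
    if m == n then cheb_moment R (m + n) 0 else 0.
  rewrite -disc_density_moment -Rintegral_cos_turn.
  rewrite -[RHS]/(fine (_%:E)) -integral_disc; last exact: continuous_cosM.
  congr fine; apply: eq_integral => p _; congr (EFin (_ * _)).
  by rewrite monomial_polar /cis; simpc.
have imE : \int[@lebesgue2 R]_p
      (complex.Im (monomial m n (polar p)) * disc_density p) = 0.
  have E := integral_disc (m + n) (@continuous_sinM R (m%:R - n%:R)).
  rewrite Rintegral_sin_turn mulr0 in E.
  apply: (etrans _ (congr1 fine E)); congr fine.
  apply: eq_integral => p _; congr (EFin (_ * _)).
  by rewrite monomial_polar /cis; simpc.
by rewrite reE imE.
Qed.

Lemma circle_measure : exists nu : probability (R * R)%type R,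
  [/\ forall A, measurable A -> nu A = (((2 * pi)^-1)%:E * arc_length A)%E,
      nu (@toC R @^-1` (~` [set z | `|z| = 1])) = 0%E &
      forall m n, cmoment nu m n = (m == n)%:R].
Proof.
have pi20 : 0 < 2 * pi :> R by rewrite mulr_gt0 // pi_gt0.
pose w t : R := (2 * pi)^-1 * \1_(@turn R) t.
pose phi t : R * R := polar (1, t).
have w0 t : 0 <= w t by rewrite mulr_ge0 // invr_ge0 ltW.
have mind : measurable_fun setT (\1_(@turn R) : R -> R).
  apply: measurable_indic; exact: measurable_turn.
have mw : measurable_fun setT w by apply: measurable_funM.
have mphi : measurable_fun setT phi.
  apply: (measurableT_comp (@measurable_polar R)).
  by apply: measurable_fun_pair => //; exact: measurable_cst.
have wint (D : set R) : measurable D ->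
    (\int[lam]_(t in D) (w t)%:E = ((2 * pi)^-1)%:E * lam (@turn R `&` D))%E.
  move=> mD; under eq_integral do rewrite EFinM.
  rewrite ge0_integralZl //.
  - by rewrite integral_indic //; exact: measurable_turn.
  - apply/measurable_EFinP; exact: measurable_funTS.
  - by rewrite lee_fin invr_ge0 ltW.
have lam_turn : lam (@turn R) = (2 * pi)%:E.
  by rewrite /turn lebesgue_measure_itv /= lte_fin pi20 -EFinD subr0.
have w1 : (\int[lam]_t (w t)%:E = 1)%E.
  by rewrite wint // setIT lam_turn -EFinM mulVf // gt_eqF.
have [nu [nuE nuI]] := @pushed_density_probability _ _ _ (R * R)%type R lam w phi
  w0 mw w1 mphi.
have nuA A : measurable A -> nu A = (((2 * pi)^-1)%:E * arc_length A)%E.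
  move=> mA; rewrite nuE // wint //.
  by rewrite -[X in measurable X]setTI; exact: mphi.
have mKC : measurable (@toC R @^-1` (~` [set z | `|z| = 1])).
  exact: measurableC (@measurable_circle R).
have nuK : nu (@toC R @^-1` (~` [set z | `|z| = 1])) = 0%E.
  rewrite nuE //.
  rewrite (_ : phi @^-1` _ = set0) ?integral_set0 //.
  by apply/seteqP; split => // t /= Kt; apply: Kt; rewrite norm_toC_polar normr1.
have nub : nu (~` box 2) = 0%E.
  apply: null_box_disc (@measurable_circle R) _ nuK => z /= ->.
  by rewrite ler1n.
exists nu; split => // m n.
rewrite (cmoment_pushed _ _ nuI nub).
have monE t : monomial m n (phi t) = cis ((m%:R - n%:R) * t).
  by rewrite monomial_polar expr1n mul1r.
have reE : \int[lam]_t (complex.Re (monomial m n (phi t)) * w t) = (m == n)%:R.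
  under eq_Rintegral do rewrite monE /w /= mulrCA.
  rewrite RintegralZl //; last first.
    apply: mul_indic_turn_integrable; exact: continuous_cosM.
  by rewrite Rintegral_cos_turn; case: eqP; rewrite ?mulr0 // mulVf // gt_eqF.
have imE : \int[lam]_t (complex.Im (monomial m n (phi t)) * w t) = 0.
  under eq_Rintegral do rewrite monE /w /= mulrCA.
  rewrite RintegralZl //; last first.
    apply: mul_indic_turn_integrable; exact: continuous_sinM.
  by rewrite Rintegral_sin_turn mulr0.
by rewrite reE imE; case: (m == n).
Qed.

End SpectralMeasures.

Theorem theorem6p3 (R : realType) :
  (chi_image (R := R) rho1 = [set z : R[i] | `|z| <= 2] /\
   exists nu1 : probability (R * R)%type R,
     is_U2_spectral_measure rho1 nu1 /\
     forall A : set (R * R), measurable A ->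
       nu1 A = integral_drdtheta 2 A (fun x =>
         (2 * pi ^+ 2)^-1 * Num.sqrt (4 - complex.Re `|x| ^+ 2))) /\
  (chi_image (R := R) rho2 = [set z : R[i] | `|z| = 1] /\
   exists nu2 : probability (R * R)%type R,
     is_U2_spectral_measure rho2 nu2 /\
     forall A : set (R * R), measurable A ->
       nu2 A = (((2 * pi)^-1)%:E * arc_length A)%E).
Proof.
rewrite chi_image_rho1 chi_image_rho2; split; split => //.
  have [nu [nuE nuK mom]] := disc_measure R; exists nu; split => //.
  rewrite /is_U2_spectral_measure fusion_mult_rho1 chi_image_rho1.
  apply: spectral_measure_of_moments => //; first exact: measurable_disc.
  by move=> m n; rewrite mom -nb_trips_shifts1 rmorph_nat.
have [nu [nuE nuK mom]] := circle_measure R; exists nu; split => //.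
rewrite /is_U2_spectral_measure fusion_mult_rho2 chi_image_rho2.
apply: spectral_measure_of_moments => //; first exact: measurable_circle.
  by move=> z /= ->; rewrite ler1n.
move=> m n; rewrite mom.
have /(congr1 (fun x : R => x%:C)) := @nb_trips_shifts2 R m n.
by rewrite !rmorph_nat => ->.
Qed.
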